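(* Let $n\ge 1$ be an integer and let $I$ be the Fisher-Bingham left ideal of the Weyl algebra $D$ in the variables $x_{ij}$ $(1\le i\le j\le n+1)$, $y_k$ $(1\le k\le n+1)$, $r$, i.e. the left ideal generated by the operators $$\partial_{ij}-\partial_i\partial_j \quad (1\le i\le j\le n+1),$$ $$\sum_{i=1}^{n+1}\partial_i^2-r^2,$$ $$x_{ij}\partial_i^2+2(x_{jj}-x_{ii})\partial_i\partial_j-x_{ij}\partial_j^2+\sum_{s\ne i,j}\left(x_{sj}\partial_i\partial_s-x_{is}\partial_j\partial_s\right)+y_j\partial_i-y_i\partial_j \quad (1\le i<j\le n+1),$$ $$r\partial_r-2\sum_{1\le i\le j\le n+1}x_{ij}\partial_i\partial_j-\sum_{i=1}^{n+1}y_i\partial_i-n.$$ Then the holonomic rank of $I$ is $$\operatorname{rank}(I)=2n+2.$$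
   Context: $D=\mathbf{C}\langle x_{ij},y_k,r,\partial_{ij},\partial_k,\partial_r \mid 1\le i\le j\le n+1,\ 1\le k\le n+1\rangle$ is the Weyl algebra, where $\partial_{ij}=\partial/\partial x_{ij}$, $\partial_k=\partial/\partial y_k$, $\partial_r=\partial/\partial r$. The convention $x_{ij}=x_{ji}$ is used for $i\neq j$ (so for $i>j$ the symbol $x_{ij}$ denotes the variable $x_{ji}$). In the sum over $s\neq i,j$, the index $s$ ranges over $\{1,\dots,n+1\}\setminus\{i,j\}$. For a left ideal $J$ of $D$, put $K=\mathbf{C}(x_{ij},y_k,r\mid 1\le i\le j\le n+1,\ 1\le k\le n+1)$ (rational function field) and let $K\langle\partial_{ij},\partial_k,\partial_r\rangle$ be the ring of differential operators with coefficients in $K$. The holonomic rank $\operatorname{rank}(J)$ is the dimension over $K$ of $K\langle\partial_{ij},\partial_k,\partial_r\rangle/K\langle\partial_{ij},\partial_k,\partial_r\rangle J$. *)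

(* Defs.v *)
From HB Require Import structures.
From mathcomp Require Import all_boot all_order all_algebra.
From mathcomp Require Import ring fraction.
From mathcomp.multinomials Require Import ssrcomplements mpoly.
From mathcomp Require Import reals complex.

Set Implicit Arguments.
Unset Strict Implicit.
Unset Printing Implicit Defensive.

Import Order.TTheory GRing.Theory Num.Theory.
Local Open Scope ring_scope.

Record comm_derivations (N : nat) (A : comNzRingType) := CommDerivations {
  der :> 'I_N -> {additive A -> A};
  derM : forall i a b, der i (a * b) = der i a * b + a * der i b;
  derC : forall i j a, der i (der j a) = der j (der i a) }.

(* The ring A<∂_1, ..., ∂_N> of differential operators with coefficients in A,
   subject to ∂_i a = a ∂_i + d_i(a) for a in A.  An operator is stored in
   normally ordered form: 'X_[m] stands for the monomial ∂^m, coefficients being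
   on the left, so that only the multiplication differs from {mpoly A[N]}. *)
Section DiffOp.
Variables (N : nat) (A : comNzRingType).

Definition diffop (d : comm_derivations N A) : Type := {mpoly A[N]}.

Variable d : comm_derivations N A.
HB.instance Definition _ := GRing.Lmodule.on (diffop d).

(* ∂_i (b ∂^m) = b ∂^(m + e_i) + d_i(b) ∂^m, extended additively *)
Definition dstep (i : 'I_N) (Q : {mpoly A[N]}) : {mpoly A[N]} :=
  'X_i * Q + map_mpoly (d i) Q.

Definition dsteps (m : 'X_{1..N}) (Q : {mpoly A[N]}) : {mpoly A[N]} :=
  foldr (fun i => iter (m i) (dstep i)) Q (enum 'I_N).

Definition diffop_mul (P Q : diffop d) : diffop d :=
  \sum_(m <- msupp P) P@_m *: dsteps m Q.

Fact dstep_is_additive i : zmod_morphism (dstep i).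
Proof. by move=> P Q; rewrite /dstep mulrBr raddfB opprD addrACA. Qed.
HB.instance Definition _ i := GRing.isZmodMorphism.Build
  {mpoly A[N]} {mpoly A[N]} (dstep i) (dstep_is_additive i).

Fact dsteps_is_additive m : zmod_morphism (dsteps m).
Proof.
move=> P Q; rewrite /dsteps; elim: (enum _) => //= i s ->.
by elim: (m i) => //= k ->; rewrite raddfB.
Qed.
HB.instance Definition _ m := GRing.isZmodMorphism.Build
  {mpoly A[N]} {mpoly A[N]} (dsteps m) (dsteps_is_additive m).

Fact map_derZ i a (Q : {mpoly A[N]}) :
  map_mpoly (d i) (a *: Q) = d i a *: Q + a *: map_mpoly (d i) Q.
Proof.
by apply/mpolyP => m; rewrite mcoeffD !mcoeffZ !mcoeff_map_mpoly mcoeffZ derM.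
Qed.

Fact map_derX i j (Q : {mpoly A[N]}) :
  map_mpoly (d i) ('X_j * Q) = 'X_j * map_mpoly (d i) Q.
Proof.
rewrite -!(commr_mpolyX U_(j)); apply/mpolyP => m; rewrite mcoeff_map_mpoly.
have [le_jm|nle_jm] := boolP (U_(j) <= m)%MM.
  by rewrite -(submK le_jm) addmC !mcoeffMX mcoeff_map_mpoly.
rewrite !memN_msupp_eq0 ?raddf0 //.
- apply: contra nle_jm; rewrite (perm_mem (msuppMX _ _)).
  by case/mapP => k _ ->; rewrite lem_addr.
- apply: contra nle_jm; rewrite (perm_mem (msuppMX _ _)).
  by case/mapP => k _ ->; rewrite lem_addr.
Qed.

Fact dstepZ i a Q : dstep i (a *: Q) = a *: dstep i Q + d i a *: Q.
Proof.
by rewrite /dstep map_derZ -scalerAr scalerDr -!addrA [_ *: Q + _]addrC.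
Qed.

Fact dstepC i j Q : dstep i (dstep j Q) = dstep j (dstep i Q).
Proof.
rewrite /dstep !raddfD /= !mulrDr !map_derX !mulrA.
have -> : map_mpoly (d i) (map_mpoly (d j) Q)
        = map_mpoly (d j) (map_mpoly (d i) Q).
  by apply/mpolyP => m; rewrite !mcoeff_map_mpoly derC.
rewrite -[X in X * Q](commr_mpolyX U_(i)) -!addrA; congr (_ + _).
by rewrite addrCA.
Qed.

Fact dsteps_comm i m Q : dsteps m (dstep i Q) = dstep i (dsteps m Q).
Proof.
rewrite /dsteps; elim: (enum _) => //= j s ->.
by elim: (m j) => //= k ->; rewrite dstepC.
Qed.

Fact dsteps0 Q : dsteps 0 Q = Q.
Proof. by rewrite /dsteps; elim: (enum _) => //= i s ->; rewrite mnm0E. Qed.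

Fact dstepsU i m Q : dsteps (m + U_(i)) Q = dstep i (dsteps m Q).
Proof.
rewrite /dsteps.
have: i \in enum 'I_N by rewrite mem_enum.
elim: (enum _) (enum_uniq 'I_N) => //= j s IHs /andP[jNs us].
have iterC k T l : iter k (dstep l) (dstep i T) = dstep i (iter k (dstep l) T).
  by elim: k => //= k ->; rewrite dstepC.
rewrite inE mnmDE mnm1E; have [-> _|neq_ij /= si] := eqVneq i j; last first.
  by rewrite addn0 IHs // iterC.
rewrite addn1 /=; congr (dstep j (iter _ _ _)).
elim: s jNs {IHs us} => //= l s IHs; rewrite inE negb_or => /andP[neq_jl /IHs ->].
by rewrite mnmDE mnm1E (negPf neq_jl) addn0.
Qed.

Fact diffop_mulwE k (P Q : diffop d) : (msize (P : {mpoly A[N]}) <= k)%N ->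
  diffop_mul P Q = \sum_(m : 'X_{1..N < k}) P@_m *: dsteps m Q.
Proof.
move=> lt_k; rewrite /diffop_mul.
pose I : subFinType _ := 'X_{1..N < k}.
rewrite (big_mksub I) /=; first last.
- by move=> x /msize_mdeg_lt/leq_trans; apply.
- by rewrite msupp_uniq.
rewrite big_rmcond //= => i /memN_msupp_eq0 ->.
by rewrite scale0r.
Qed.

Fact diffop_mulBl P1 P2 Q :
  diffop_mul (P1 - P2) Q = diffop_mul P1 Q - diffop_mul P2 Q.
Proof.
pose k := maxn (msize (P1 - P2 : {mpoly A[N]})) (maxn (msize P1) (msize P2)).
rewrite !(@diffop_mulwE k) ?leq_max ?leqnn ?orbT // -sumrB.
by apply: eq_bigr => m _; rewrite mcoeffB scalerBl.
Qed.

Definition diffop_mulr Q P := diffop_mul P Q.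
HB.instance Definition _ Q := GRing.isZmodMorphism.Build
  (diffop d) (diffop d) (diffop_mulr Q) (fun P1 P2 => diffop_mulBl P1 P2 Q).

Fact diffop_mulDl : left_distributive diffop_mul +%R.
Proof. by move=> P1 P2 Q; exact: (raddfD (diffop_mulr Q)). Qed.

Fact diffop_mulDr : right_distributive diffop_mul +%R.
Proof.
move=> P Q1 Q2; rewrite /diffop_mul -big_split /=.
by apply: eq_bigr => m _; rewrite raddfD scalerDr.
Qed.

Fact diffop_mulZl a P Q : a *: diffop_mul P Q = diffop_mul (a *: P) Q.
Proof.
pose k := maxn (msize (a *: P : {mpoly A[N]})) (msize P).
rewrite !(@diffop_mulwE k) ?leq_max ?leqnn ?orbT // scaler_sumr.
by apply: eq_bigr => m _; rewrite mcoeffZ scalerA.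
Qed.

Fact diffop_mulXl m Q : diffop_mul 'X_[m] Q = dsteps m Q.
Proof. by rewrite /diffop_mul msuppX big_seq1 mcoeffX eqxx scale1r. Qed.

Fact diffop_mul1l : left_id (1 : {mpoly A[N]}) diffop_mul.
Proof. by move=> Q; rewrite -mpolyX0 diffop_mulXl dsteps0. Qed.

Fact dstep1 i m : dstep i 'X_[m] = 'X_[m + U_(i)].
Proof.
rewrite /dstep; have -> : map_mpoly (d i) 'X_[m] = 0.
  have d1 : d i 1 = 0.
    have := derM d i 1 1; rewrite !mulr1 mul1r => /eqP.
    by rewrite -subr_eq subrr => /eqP <-.
  by apply/mpolyP => k; rewrite mcoeff_map_mpoly mcoeffX mcoeff0; case: eqP;
    rewrite ?raddf0.
by rewrite addr0 mpolyXD -commr_mpolyX.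
Qed.

Fact mnm_ind (P : 'X_{1..N} -> Prop) :
  P 0%MM -> (forall i m, P m -> P (m + U_(i))%MM) -> forall m, P m.
Proof.
move=> P0 PU m; have [k] := ubnP (mdeg m); elim: k m => // k IH m.
have [/eqP|] := eqVneq (mdeg m) 0%N; first by rewrite mdeg_eq0 => /eqP ->.
rewrite mdeg_eq0 => m0 lt_mk.
have [i mi] : exists i, (m i != 0)%N.
  apply/existsP; apply: contraR m0; rewrite negb_exists => /forallP m0.
  by apply/eqP/mnmP => i; rewrite mnm0E; apply/eqP/negPn/m0.
have le_im : (U_(i) <= m)%MM.
  by apply/mnm_lepP => j; rewrite mnm1E; case: eqP => // <-; rewrite lt0n.
rewrite -(submK le_im); apply: PU; apply: IH.
by move: lt_mk; rewrite -{1}(submK le_im) mdegD mdeg1 addn1 ltnS.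
Qed.

Fact dsteps1 m : dsteps m 1 = 'X_[m].
Proof.
elim/mnm_ind: m => [|i m IH]; first by rewrite dsteps0 mpolyX0.
by rewrite dstepsU IH dstep1.
Qed.

Fact diffop_mulr1 : right_id (1 : {mpoly A[N]}) diffop_mul.
Proof.
move=> P; rewrite /diffop_mul [RHS]mpolyE.
by apply: eq_bigr => m _; rewrite dsteps1.
Qed.

Fact diffop_mul_dstep i Q S : diffop_mul (dstep i Q) S = dstep i (diffop_mul Q S).
Proof.
elim/mpolyind: Q => [|c m Q _ _ IH].
  by rewrite raddf0 -[LHS]/(diffop_mulr S 0) -[X in dstep i X]/(diffop_mulr S 0) !raddf0.
rewrite raddfD /= (diffop_mulDl (dstep _ _)) IH (diffop_mulDl (c *: _)) raddfD /=.
congr (_ + _).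
rewrite dstepZ dstep1 diffop_mulDl -!diffop_mulZl !diffop_mulXl.
by rewrite dstepZ dstepsU.
Qed.

Fact diffop_mul_dsteps m Q S :
  diffop_mul (dsteps m Q) S = dsteps m (diffop_mul Q S).
Proof.
elim/mnm_ind: m => [|i m IH]; first by rewrite !dsteps0.
by rewrite !dstepsU diffop_mul_dstep IH.
Qed.

Fact diffop_mulA : associative diffop_mul.
Proof.
move=> P Q S; rewrite {1 4}/diffop_mul.
rewrite -[RHS]/(diffop_mulr S _) raddf_sum /=; apply: eq_bigr => m _.
by rewrite /diffop_mulr -diffop_mulZl diffop_mul_dsteps.
Qed.

Fact diffop1_neq0 : (1 : {mpoly A[N]}) != 0 :> diffop d.
Proof. exact: oner_neq0. Qed.

HB.instance Definition _ := GRing.Zmodule_isNzRing.Build (diffop d)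
  diffop_mulA diffop_mul1l diffop_mulr1 diffop_mulDl diffop_mulDr diffop1_neq0.

(* The function a, seen as an operator of order 0, is a%:A = a *: 1, and
   a *: P = a%:A * P. *)
HB.instance Definition _ := GRing.Lmodule_isLalgebra.Build A (diffop d) diffop_mulZl.

Definition partial (i : 'I_N) : diffop d := ('X_i : {mpoly A[N]}).

Lemma partialE i (Q : diffop d) : partial i * Q = dstep i Q.
Proof.
by rewrite /GRing.mul /= diffop_mulXl -[U_(i)%MM]add0m dstepsU dsteps0.
Qed.

Lemma partial_comm i j : partial i * partial j = partial j * partial i.
Proof. by rewrite !partialE /partial !dstep1 addmC. Qed.

Lemma partial_leibniz i a :
  partial i * a%:A = a%:A * partial i + (d i a)%:A.
Proof.
rewrite partialE dstepZ -[a%:A * _]scalerAl mul1r.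
by congr (_ *: _ + _); rewrite -partialE mulr1.
Qed.

End DiffOp.

Section DiffOpMap.
Variables (N : nat) (A B : comNzRingType).
Variables (dA : comm_derivations N A) (dB : comm_derivations N B).
Variable f : {rmorphism A -> B}.

Definition diffop_map (P : diffop dA) : diffop dB := map_mpoly f P.

Fact diffop_map_is_additive : zmod_morphism diffop_map.
Proof. by move=> P Q; exact: (raddfB (map_mpoly f)). Qed.
HB.instance Definition _ := GRing.isZmodMorphism.Build
  (diffop dA) (diffop dB) diffop_map diffop_map_is_additive.

Lemma diffop_map_partial i : diffop_map (partial _ i) = partial _ i.
Proof. exact: map_mpolyX. Qed.

Lemma diffop_mapZ a P : diffop_map (a *: P) = f a *: diffop_map P.
Proof. exact: map_mpolyZ. Qed.

Hypothesis f_der : forall i a, f (dA i a) = dB i (f a).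
Hypothesis f_inj : injective f.

Fact diffop_map_dstep i Q :
  map_mpoly f (dstep dA i Q) = dstep dB i (map_mpoly f Q).
Proof.
rewrite /dstep rmorphD rmorphM /= map_mpolyX; congr (_ + _).
by apply/mpolyP => m; rewrite !mcoeff_map_mpoly /= f_der.
Qed.

Fact diffop_map_dsteps m Q :
  map_mpoly f (dsteps dA m Q) = dsteps dB m (map_mpoly f Q).
Proof.
rewrite /dsteps; elim: (enum _) => //= i s <-.
by elim: (m i) => //= k <-; rewrite diffop_map_dstep.
Qed.

Lemma diffop_map_is_monoid_morphism : monoid_morphism diffop_map.
Proof.
split=> [|P Q]; first exact: (rmorph1 (map_mpoly f)).
rewrite /GRing.mul /= /diffop_mul raddf_sum /=.
rewrite [RHS](perm_big _ (msupp_map_mpoly P f_inj)) /=.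
apply: eq_bigr => m _; rewrite diffop_mapZ mcoeff_map_mpoly /diffop_map.
by rewrite diffop_map_dsteps.
Qed.

End DiffOpMap.

Definition poly_der (F : fieldType) (N : nat) : comm_derivations N {mpoly F[N]} :=
  @CommDerivations N {mpoly F[N]} (fun i => mderiv i : {additive _ -> _})
    (fun i p q => mderivM i p q) (fun i j p => mderiv_comm j i p).

(* The unique extension of a derivation of A to Frac(A), by the quotient rule *)
Section FracDer.
Variables (A : idomainType) (D : {additive A -> A}).
Hypothesis DM : forall a b, D (a * b) = D a * b + a * D b.
Local Notation "a %:F" := (@FracField.tofrac A a).

Definition frac_der (x : {fraction A}) : {fraction A} :=
  let r := repr x in
  (D \n_r * \d_r - \n_r * D \d_r)%:F / (\d_r ^+ 2)%:F.

Lemma frac_numden (x : {fraction A}) : x * (\d_(repr x))%:F = (\n_(repr x))%:F.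
Proof.
rewrite -{1}[x]reprK; set r := repr x.
unlock FracField.tofrac; rewrite -[LHS]FracField.pi_mul.
apply/eqmodP => /=; rewrite FracField.equivfE /FracField.mulf.
by rewrite !numden_Ratio ?mulr1 ?oner_eq0 ?denom_ratioP // mulrC.
Qed.

Lemma frac_derE x n q : q != 0 -> x * q%:F = n%:F ->
  frac_der x * q%:F = (D n)%:F - x * (D q)%:F.
Proof.
move=> q0 xq; have := frac_numden x; rewrite /frac_der.
set n' := \n_ _; set q' := \d_ _ => xq'.
have q'0 : q'%:F != 0 by rewrite tofrac_eq0 denom_ratioP.
have qF0 : q%:F != 0 by rewrite tofrac_eq0.
have nq : n * q' = n' * q.
  by apply/eqP; rewrite -tofrac_eq !tofracM -xq -xq' mulrAC.
have := congr1 (fun a => (D a)%:F) nq.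
rewrite /= !DM !(tofracXn, tofracD, tofracN, tofracM) => Dnq.
apply: (mulIf (expf_neq0 2 q'0)).
rewrite mulrAC mulfVK ?expf_neq0 //.
have -> : ((D n)%:F - x * (D q)%:F) * q'%:F ^+ 2
        = (D n)%:F * q'%:F * q'%:F - x * (D q)%:F * q'%:F ^+ 2 by ring.
have -> : (D n)%:F * q'%:F
        = (D n')%:F * q%:F + n'%:F * (D q)%:F - n%:F * (D q')%:F.
  by rewrite -Dnq addrK.
by rewrite -xq -xq'; ring.
Qed.

Lemma frac_der_tofrac a : frac_der a%:F = (D a)%:F.
Proof.
have D1 : D 1 = 0.
  by have /eqP := DM 1 1; rewrite !mulr1 mul1r -subr_eq subrr => /eqP <-.
have := @frac_derE a%:F a 1 (oner_neq0 _).
by rewrite D1 tofrac0 tofrac1 !mulr1 mulr0 subr0; apply.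
Qed.

Lemma frac_derM x y : frac_der (x * y) = frac_der x * y + x * frac_der y.
Proof.
have [xq yq] := (frac_numden x, frac_numden y).
move: (\n__) (\d_(repr x)) (denom_ratioP (repr x)) xq => n q q0 xq.
move: (\n__) (\d_(repr y)) (denom_ratioP (repr y)) yq => m p p0 yp.
have pF0 : p%:F != 0 by rewrite tofrac_eq0.
have qF0 : q%:F != 0 by rewrite tofrac_eq0.
apply: (mulIf (mulf_neq0 qF0 pF0)); rewrite -tofracM.
rewrite (@frac_derE _ (n * m)) ?mulf_neq0 //; last first.
  by rewrite !tofracM -xq -yp mulrACA.
have Dx := frac_derE q0 xq; have Dy := frac_derE p0 yp.
have -> : (frac_der x * y + x * frac_der y) * (q * p)%:F
        = (frac_der x * q%:F) * (y * p%:F) + (x * q%:F) * (frac_der y * p%:F).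
  by rewrite tofracM; ring.
rewrite Dx Dy !DM !(tofracD, tofracM) -xq -yp; ring.
Qed.

Fact frac_der_is_additive : zmod_morphism frac_der.
Proof.
move=> x y.
have [xq yq] := (frac_numden x, frac_numden y).
move: (\n__) (\d_(repr x)) (denom_ratioP (repr x)) xq => n q q0 xq.
move: (\n__) (\d_(repr y)) (denom_ratioP (repr y)) yq => m p p0 yp.
have pF0 : p%:F != 0 by rewrite tofrac_eq0.
have qF0 : q%:F != 0 by rewrite tofrac_eq0.
apply: (mulIf (mulf_neq0 qF0 pF0)); rewrite -tofracM.
rewrite (@frac_derE _ (n * p - m * q)) ?mulf_neq0 //; last first.
  by rewrite !(tofracD, tofracN, tofracM) -xq -yp; ring.
have Dx := frac_derE q0 xq; have Dy := frac_derE p0 yp.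
have -> : (frac_der x - frac_der y) * (q * p)%:F
        = (frac_der x * q%:F) * p%:F - (frac_der y * p%:F) * q%:F.
  by rewrite tofracM; ring.
rewrite Dx Dy raddfB /= !DM !(tofracD, tofracN, tofracM) -xq -yp; ring.
Qed.

Definition frac_der_additive : {additive {fraction A} -> {fraction A}} :=
  HB.pack frac_der
    (GRing.isZmodMorphism.Build _ _ frac_der frac_der_is_additive).

End FracDer.

Section FracDers.
Variables (N : nat) (A : idomainType) (d : comm_derivations N A).

Fact frac_ders_comm i j (x : {fraction A}) :
  frac_der (d i) (frac_der (d j) x) = frac_der (d j) (frac_der (d i) x).
Proof.
have xq := frac_numden x.
move: (\n__) (\d__) (denom_ratioP (repr x)) xq => n q q0 xq.
have qF0 : FracField.tofrac q != 0 by rewrite tofrac_eq0.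
have dd k l : frac_der (d k) (frac_der (d l) x) * FracField.tofrac q =
  FracField.tofrac (d k (d l n)) - frac_der (d k) x * FracField.tofrac (d l q)
  - x * FracField.tofrac (d k (d l q))
  - frac_der (d l) x * FracField.tofrac (d k q).
  have /(congr1 (frac_der (d k))) := frac_derE (derM d l) q0 xq.
  rewrite (frac_derM (derM d k)) (frac_der_is_additive (derM d k)).
  rewrite (frac_derM (derM d k)) !(frac_der_tofrac (derM d k)) => /eqP.
  by rewrite -subr_eq opprK => /eqP <-; ring.
apply: (mulIf qF0); rewrite !dd ![d j (d i _)]derC; ring.
Qed.

Definition frac_ders : comm_derivations N {fraction A} :=
  @CommDerivations N {fraction A}
    (fun i => frac_der_additive (derM d i))
    (fun i => frac_derM (derM d i)) frac_ders_comm.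

End FracDers.

Definition weyl (F : fieldType) (N : nat) := diffop (poly_der F N).

Definition rat_weyl (F : fieldType) (N : nat) := diffop (frac_ders (poly_der F N)).

Definition weyl_to_rat (F : fieldType) (N : nat) (P : weyl F N) : rat_weyl F N :=
  diffop_map (dA := poly_der F N) (frac_ders (poly_der F N))
    (@FracField.tofrac {mpoly F[N]}) P.

Fact weyl_to_rat_is_additive F N : zmod_morphism (@weyl_to_rat F N).
Proof. exact: diffop_map_is_additive. Qed.
HB.instance Definition _ F N := GRing.isZmodMorphism.Build
  (weyl F N) (rat_weyl F N) (@weyl_to_rat F N) (@weyl_to_rat_is_additive F N).

Fact weyl_to_rat_is_monoid_morphism F N : monoid_morphism (@weyl_to_rat F N).
Proof.
apply: diffop_map_is_monoid_morphism => [i a|a b /eqP].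
  by rewrite /= (frac_der_tofrac (derM (poly_der F N) i)).
by rewrite tofrac_eq => /eqP.
Qed.
HB.instance Definition _ F N := GRing.isMonoidMorphism.Build
  (weyl F N) (rat_weyl F N) (@weyl_to_rat F N)
  (@weyl_to_rat_is_monoid_morphism F N).

Definition left_ideal_gen (R : nzRingType) (S : R -> Prop) (P : R) : Prop :=
  exists (m : nat) (a g : 'I_m -> R),
    (forall k, S (g k)) /\ P = \sum_(k < m) a k * g k.

(* dim_K (V / W) = r, for W a K-subspace of V: the classes of some r vectors
   form a basis of V / W *)
Definition quotient_dim (K : fieldType) (V : lmodType K) (W : V -> Prop)
    (r : nat) : Prop :=
  exists e : 'I_r -> V,
    (forall v, exists c : 'I_r -> K, W (v - \sum_k c k *: e k)) /\
    (forall c : 'I_r -> K, W (\sum_k c k *: e k) -> forall k, c k = 0).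

Definition has_holonomic_rank (F : fieldType) (N : nat) (J : weyl F N -> Prop)
    (r : nat) : Prop :=
  quotient_dim
    (left_ideal_gen
       (fun Q : rat_weyl F N => exists2 P, J P & Q = weyl_to_rat P)) r.

Section FisherBingham.
Variables (F : fieldType) (n : nat).
Local Notation idx := 'I_n.+1.

(* Indices run over 0, ..., n instead of 1, ..., n+1.  The summands index the
   variables x_ij (i <= j), y_k and r respectively. *)
Definition upper_pair : Type := {p : idx * idx | (p.1 <= p.2)%N}.
HB.instance Definition _ := Finite.on upper_pair.

Definition fb_var : Type := (upper_pair + idx + unit)%type.
HB.instance Definition _ := Finite.on fb_var.

Fact sort_pairP (i j : idx) :
  let p := if (i <= j)%N then (i, j) else (j, i) in (p.1 <= p.2)%N.
Proof. by case: (leqP i j) => //= /ltnW. Qed.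

Definition sort_pair (i j : idx) : upper_pair :=
  exist (fun p : idx * idx => p.1 <= p.2)%N _ (sort_pairP i j).

Definition fb_weyl := weyl F #|{: fb_var}|.

Definition fb_coord (v : fb_var) : fb_weyl :=
  ('X_(enum_rank v) : {mpoly F[#|{: fb_var}|]})%:A.
Definition fb_partial (v : fb_var) : fb_weyl := partial _ (enum_rank v).

Lemma fb_weyl_relation (v w : fb_var) :
  fb_partial v * fb_coord w = fb_coord w * fb_partial v + (v == w)%:R.
Proof.
rewrite /fb_partial /fb_coord [LHS]partial_leibniz; congr (_ + _).
rewrite /= mderivX mnm1E (inj_eq enum_rank_inj) eq_sym.
case: eqP => [->|_]; last by rewrite !scale0r.
rewrite scale1r; have -> : (U_(enum_rank w) - U_(enum_rank w))%MM = 0%MM.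
  by apply/mnmP => k; rewrite mnmBE mnm0E subnn.
by rewrite mpolyX0 scale1r.
Qed.

Definition fb_x (i j : idx) := fb_coord (inl (inl (sort_pair i j))).
Definition fb_y (k : idx) := fb_coord (inl (inr k)).
Definition fb_r := fb_coord (inr tt).
Definition fb_dx (i j : idx) := fb_partial (inl (inl (sort_pair i j))).
Definition fb_dy (k : idx) := fb_partial (inl (inr k)).
Definition fb_dr := fb_partial (inr tt).

Lemma fb_x_sym (i j : idx) : fb_x i j = fb_x j i.
Proof.
rewrite /fb_x; congr (fb_coord (inl (inl _))); apply: val_inj => /=.
by case: ltngtP => // /val_inj ->.
Qed.

Local Notation x := fb_x.
Local Notation y := fb_y.
Local Notation r := fb_r.
Local Notation dx := fb_dx.
Local Notation d := fb_dy.
Local Notation dr := fb_dr.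

Definition fb_gen_xx (i j : idx) : fb_weyl := dx i j - d i * d j.

Definition fb_gen_sphere : fb_weyl := \sum_i d i ^+ 2 - r ^+ 2.

Definition fb_gen_rot (i j : idx) : fb_weyl :=
  x i j * d i ^+ 2 + 2 * (x j j - x i i) * d i * d j - x i j * d j ^+ 2
  + \sum_(s | (s != i) && (s != j)) (x s j * d i * d s - x i s * d j * d s)
  + y j * d i - y i * d j.

Definition fb_gen_euler : fb_weyl :=
  r * dr - 2 * \sum_(i : idx) \sum_(j : idx | (i <= j)%N) x i j * d i * d j
  - \sum_i y i * d i - n%:R.

Definition fb_generator (P : fb_weyl) : Prop :=
  [\/ exists i j : idx, (i <= j)%N /\ P = fb_gen_xx i j,
      P = fb_gen_sphere,
      exists i j : idx, (i < j)%N /\ P = fb_gen_rot i j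
    | P = fb_gen_euler].

Definition fisher_bingham_ideal : fb_weyl -> Prop :=
  left_ideal_gen fb_generator.

End FisherBingham.

(* Main.v *)
(* Write t_i for the class of d_i modulo the ideal, N = n + 1, and X for the
   symmetric matrix of the quadratic form, X_ii = x_ii and X_ij = x_ij / 2.  The
   2N elements t_i and t_i^2 form a basis.

   Spanning.  Modulo terms of lower degree the rotation operators say that X
   commutes with the matrix (t_i t_j).  At the point X = diag(0, ..., n) they kill
   the products t_i t_j with i <> j, and together with the sphere relation all
   cubic monomials; by semicontinuity of rank this persists at the generic point.

   Independence.  The Fisher-Bingham integral is the inverse Laplace transform in
   r^2 of a Gaussian integral, that is, up to a factor, the integral over s of
     r exp(r^2 s + y^T (s - X)^-1 y / 4) det(s - X)^(-1/2).
   Hence the operators act on the functions of s over C(x, y, r) by derivations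
   twisted by the logarithmic derivatives of this integrand, and an operator of
   the ideal applied to 1 gives a twisted derivative d/ds of a function whose only
   poles are the zeros of D = char_poly X.  The images of t_i and t_i^2 are h / D^2
   with deg h < 2N; comparing poles and degrees, such a function is a twisted
   derivative only if it is zero.  The 2N numerators h are linearly independent,
   as one sees at X = diag(0, ..., n), y = (1, ..., 1). *)

From HB Require Import structures.
Require Import Defs.
From mathcomp Require Import all_boot all_order all_algebra.
From mathcomp Require Import ring zify fraction.
From mathcomp.multinomials Require Import ssrcomplements mpoly.
From mathcomp Require Import reals complex.

Set Implicit Arguments.
Unset Strict Implicit.
Unset Printing Implicit Defensive.

Import Order.TTheory GRing.Theory Num.Theory.
Local Open Scope ring_scope.

(** * Modules over rings of differential operators *)

Section Action.
Variables (N : nat) (K L : comNzRingType) (dK : comm_derivations N K).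
Variables (f : {rmorphism K -> L}) (T : 'I_N -> {additive L -> L}).
Hypothesis TM : forall i a h, T i (f a * h) = f a * T i h + f (dK i a) * h.
Hypothesis TC : forall i j h, T i (T j h) = T j (T i h).

Definition act_mon (m : 'X_{1..N}) (h : L) : L :=
  foldr (fun i => iter (m i) (T i)) h (enum 'I_N).

(** The operator [P] applied to [h] in the left module [L] where the i-th partial acts by [T i] and
    scalars act through [f]; [TM] is the Leibniz rule this requires. *)
Definition act (h : L) (P : diffop dK) : L :=
  \sum_(m <- msupp P) f P@_m * act_mon m h.

Lemma act_monU i m h : act_mon (m + U_(i))%MM h = T i (act_mon m h).
Proof.
rewrite /act_mon.
have iterT k j l g : iter k (T j) (T l g) = T l (iter k (T j) g).
  by elim: k => //= k ->; rewrite TC.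
have foldT s j g :
    foldr (fun l => iter (m l) (T l)) (T j g) s
    = T j (foldr (fun l => iter (m l) (T l)) g s).
  by elim: s => //= l s ->; rewrite iterT.
have: i \in enum 'I_N by rewrite mem_enum.
elim: (enum _) (enum_uniq 'I_N) => //= j s IHs /andP[jNs us].
rewrite inE mnmDE mnm1E; have [-> _|neq_ij /= si] := eqVneq i j; last first.
  by rewrite addn0 IHs // iterT.
rewrite addn1 /=; congr (T j (iter _ _ _)).
elim: s jNs {IHs us} => //= l s IHs; rewrite !inE negb_or => /andP[neq_il /IHs ->].
by rewrite mnmDE mnm1E (negPf neq_il) addn0.
Qed.

Lemma act_mon0 h : act_mon 0 h = h.
Proof. by rewrite /act_mon; elim: (enum _) => //= i s ->; rewrite mnm0E. Qed.

Lemma act_sumE h k (P : diffop dK) : (msize (P : {mpoly K[N]}) <= k)%N ->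
  act h P = \sum_(m : 'X_{1..N < k}) f P@_m * act_mon m h.
Proof.
move=> leP; rewrite /act (big_mksub 'X_{1..N < k}) ?msupp_uniq //=; last first.
  by move=> m /msize_mdeg_lt/leq_trans; apply.
by rewrite big_rmcond //= => m /memN_msupp_eq0->; rewrite rmorph0 mul0r.
Qed.

Lemma act_is_additive h : zmod_morphism (act h).
Proof.
move=> P Q; pose k := maxn (msize (P - Q : {mpoly K[N]})) (maxn (msize P) (msize Q)).
rewrite !(@act_sumE h k) ?leq_max ?leqnn ?orbT // -sumrB.
by apply: eq_bigr => m _; rewrite mcoeffB rmorphB mulrBl.
Qed.
HB.instance Definition _ h :=
  GRing.isZmodMorphism.Build (diffop dK) L (act h) (act_is_additive h).

Lemma actZ h a P : act h (a *: P) = f a * act h P.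
Proof.
pose k := maxn (msize (a *: P : {mpoly K[N]})) (msize P).
rewrite !(@act_sumE h k) ?leq_max ?leqnn ?orbT // mulr_sumr.
by apply: eq_bigr => m _; rewrite mcoeffZ rmorphM mulrA.
Qed.

Lemma actX h m : act h ('X_[m] : {mpoly K[N]}) = act_mon m h.
Proof. by rewrite /act msuppX big_seq1 mcoeffX eqxx rmorph1 mul1r. Qed.

Lemma act1 h : act h 1 = h.
Proof. by rewrite -[1]/(1 : {mpoly K[N]}) -mpolyX0 actX act_mon0. Qed.

Lemma act_dstep h i (Q : {mpoly K[N]}) : act h (dstep dK i Q) = T i (act h Q).
Proof.
have actD (U V : {mpoly K[N]}) : act h (U + V) = act h U + act h V.
  exact: (raddfD (act h)).
elim/mpolyind: Q => [|c m Q _ _ IH]; first by rewrite !raddf0.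
have -> : dstep dK i (c *: 'X_[m] + Q) = dstep dK i (c *: 'X_[m]) + dstep dK i Q.
  exact: (raddfD (dstep dK i)).
rewrite actD IH (actD (c *: 'X_[m]) Q) (raddfD (T i)); congr (_ + _).
rewrite dstepZ dstep1 actD -[_ *: 'X_[_ + _]]/(_ *: ('X_[_] : diffop dK)).
by rewrite !actZ !actX act_monU TM.
Qed.

Lemma act_partial h i (Q : diffop dK) : act h (partial dK i * Q) = T i (act h Q).
Proof. by rewrite partialE act_dstep. Qed.

(** Allows an ideal to be tested on its generators: left multiplication by [P] amounts to a sum of
    scalars times iterated [T i], and a subspace stable under both absorbs it. *)
Lemma act_closed (E : L -> Prop) h (P Q : diffop dK) :
  E 0 -> (forall u v, E u -> E v -> E (u + v)) ->
  (forall a u, E u -> E (f a * u)) -> (forall i u, E u -> E (T i u)) ->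
  E (act h Q) -> E (act h (P * Q)).
Proof.
move=> E0 ED EZ ET EQ; rewrite [P * Q]/GRing.mul /= /diffop_mul raddf_sum /=.
elim/big_ind: _ => // m _; rewrite actZ; apply: EZ.
elim/mnm_ind: m => [|i m IH]; first by rewrite dsteps0.
by rewrite dstepsU act_dstep; apply: ET.
Qed.

End Action.

(* Index ord0 stands for d/ds, index lift ord0 i for the i-th derivation of A. *)
Section PolyDers.
Variables (N : nat) (A : comNzRingType) (d : comm_derivations N A).

Definition coef_der (D : {additive A -> A}) (p : {poly A}) : {poly A} := map_poly D p.

Lemma coef_derE D p k : (coef_der D p)`_k = D p`_k.
Proof. by rewrite coef_map_id0 ?raddf0. Qed.

Fact coef_der_is_additive D : zmod_morphism (coef_der D).
Proof. by move=> p q; apply/polyP=> k; rewrite !(coefB, coef_derE) raddfB. Qed.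
HB.instance Definition _ D :=
  GRing.isZmodMorphism.Build {poly A} {poly A} (coef_der D) (coef_der_is_additive D).

Definition poly_ders_fun (i : 'I_N.+1) : {additive {poly A} -> {poly A}} :=
  if unlift ord0 i is Some j then coef_der (d j) else deriv.

Fact poly_ders_funM i p q :
  poly_ders_fun i (p * q) = poly_ders_fun i p * q + p * poly_ders_fun i q.
Proof.
rewrite /poly_ders_fun; case: unliftP => [j|] _ /=; last by rewrite derivM.
apply/polyP=> k; rewrite coef_derE coefD !coefM raddf_sum -big_split /=.
by apply: eq_bigr => l _; rewrite derM !coef_derE.
Qed.

Fact poly_ders_funC i j p :
  poly_ders_fun i (poly_ders_fun j p) = poly_ders_fun j (poly_ders_fun i p).
Proof.
rewrite /poly_ders_fun; case: unliftP => [k|] _; case: unliftP => [l|] _ //=;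
  apply/polyP=> m; rewrite ?(coef_derE, coef_deriv) ?raddfMn //; exact: derC.
Qed.

Definition poly_ders : comm_derivations N.+1 {poly A} :=
  CommDerivations poly_ders_funM poly_ders_funC.

End PolyDers.

(** * The generators over the field of rational functions *)

Section ImageInAlgebra.
Variables (D : nzRingType) (K : comNzRingType) (U : lalgType K).
Variables (w : {rmorphism D -> U}) (V : Type) (C P : V -> D) (c : V -> K) (p : V -> U).
Hypotheses (wC : forall v, w (C v) = (c v)%:A) (wP : forall v, w (P v) = p v).

Lemma const_mull (a : K) (Q : U) : a%:A * Q = a *: Q.
Proof. by rewrite -scalerAl mul1r. Qed.

Lemma nat_const k : k%:R = k%:R%:A :> U.
Proof. by rewrite scaler_nat. Qed.

Local Definition imgE :=
  (rmorph_nat, rmorphXn, rmorphN, rmorphD, rmorphM, rmorph_sum).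

(** The three images depend only on the values of [w] on coordinates and partials; coordinates turn
    into scalars, the form needed for linear algebra modulo the ideal. *)
Lemma image_sphere (I : finType) (d : I -> V) r :
  w (\sum_i P (d i) ^+ 2 - C r ^+ 2)
  = \sum_i p (d i) * p (d i) - (c r ^+ 2)%:A.
Proof.
rewrite !imgE /= wC [_%:A ^+ 2]expr2 const_mull scalerA -expr2.
by congr (_ - _); apply: eq_bigr => i _; rewrite rmorphXn /= wP expr2.
Qed.

Lemma image_rot (I : finType) (Q : pred I) (xij xjj xii yi yj di dj : V)
    (xi xj ds : I -> V) :
  w (C xij * P di ^+ 2 + 2 * (C xjj - C xii) * P di * P dj - C xij * P dj ^+ 2
     + \sum_(s | Q s) (C (xj s) * P di * P (ds s) - C (xi s) * P dj * P (ds s))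
     + C yj * P di - C yi * P dj) =
  c xij *: (p di * p di) + (2 * (c xjj - c xii)) *: (p di * p dj)
  - c xij *: (p dj * p dj)
  + \sum_(s | Q s) (c (xj s) *: (p di * p (ds s)) - c (xi s) *: (p dj * p (ds s)))
  + c yj *: p di - c yi *: p dj.
Proof.
rewrite !imgE /= !wC !wP nat_const -scalerBl !const_mull scalerA -!scalerAl !expr2.
rewrite mul1r; congr (_ + _ + _ - _); apply: eq_bigr => s _.
by rewrite !imgE /= !wC !wP !const_mull -!scalerAl.
Qed.

Lemma image_euler (I : finType) (Q : I -> pred I) (r dr : V) (x : I -> I -> V)
    (y d : I -> V) k :
  w (C r * P dr - 2 * \sum_i \sum_(j | Q i j) C (x i j) * P (d i) * P (d j)
     - \sum_i C (y i) * P (d i) - k%:R) =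
  c r *: p dr - \sum_i \sum_(j | Q i j) (2 * c (x i j)) *: (p (d i) * p (d j))
  - \sum_i c (y i) *: p (d i) - k%:R%:A.
Proof.
rewrite !imgE /= !wC !wP !nat_const !const_mull.
congr (_ - _ - _ - _).
  rewrite scaler_sumr; apply: eq_bigr => i _.
  rewrite rmorph_sum scaler_sumr; apply: eq_bigr => j _.
  by rewrite !imgE /= !wC !wP const_mull -scalerAl scalerA.
by apply: eq_bigr => i _; rewrite !imgE /= wC wP const_mull.
Qed.

End ImageInAlgebra.

Section FBImages.
Variables (F : fieldType) (n : nat).
Local Notation idx := 'I_n.+1.
Local Notation M := #|{: fb_var n}|.
Local Notation A := {mpoly F[M]}.
Local Notation K := {fraction A}.
Local Notation U := (rat_weyl F M).

Definition poly_coord (v : fb_var n) : A := 'X_(enum_rank v).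
Definition rat_coord (v : fb_var n) : K := FracField.tofrac (poly_coord v).
Definition rat_partial (v : fb_var n) : U := partial _ (enum_rank v).

Local Notation x i j := (rat_coord (inl (inl (sort_pair i j)))).
Local Notation y i := (rat_coord (inl (inr i))).
Local Notation r := (rat_coord (inr tt)).
Local Notation dx i j := (rat_partial (inl (inl (sort_pair i j)))).
Local Notation d i := (rat_partial (inl (inr i))).
Local Notation dr := (rat_partial (inr tt)).

Lemma weyl_to_rat_coord v : weyl_to_rat (fb_coord F v) = (rat_coord v)%:A.
Proof. by rewrite /weyl_to_rat diffop_mapZ -[diffop_map _ _ _]/(weyl_to_rat 1) rmorph1. Qed.

Lemma weyl_to_rat_partial v : weyl_to_rat (fb_partial F v) = rat_partial v.
Proof. exact: diffop_map_partial. Qed.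

Lemma weyl_to_rat_xx i j : weyl_to_rat (fb_gen_xx F i j) = dx i j - d i * d j.
Proof. by rewrite rmorphB rmorphM /= !weyl_to_rat_partial. Qed.

Lemma weyl_to_rat_sphere :
  weyl_to_rat (fb_gen_sphere F n) = \sum_i d i * d i - (r ^+ 2)%:A.
Proof. exact: (image_sphere weyl_to_rat_coord weyl_to_rat_partial). Qed.

Lemma weyl_to_rat_rot i j : weyl_to_rat (fb_gen_rot F i j) =
  x i j *: (d i * d i) + (2 * (x j j - x i i)) *: (d i * d j) - x i j *: (d j * d j)
  + \sum_(s | (s != i) && (s != j)) (x s j *: (d i * d s) - x i s *: (d j * d s))
  + y j *: d i - y i *: d j.
Proof.
exact: (image_rot weyl_to_rat_coord weyl_to_rat_partial _ _ _ _ _ _ _ _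
  (fun s => inl (inl (sort_pair i s))) (fun s => inl (inl (sort_pair s j)))
  (fun s => inl (inr s))).
Qed.

Lemma weyl_to_rat_euler : weyl_to_rat (fb_gen_euler F n) =
  r *: dr - \sum_(i : idx) \sum_(j : idx | (i <= j)%N) (2 * x i j) *: (d i * d j)
  - \sum_i y i *: d i - n%:R%:A.
Proof.
exact: (image_euler weyl_to_rat_coord weyl_to_rat_partial _ _ _
  (fun i j => inl (inl (sort_pair i j))) (fun i => inl (inr i))
  (fun i => inl (inr i))).
Qed.

End FBImages.

(** * Generators of the quotient *)

Section Nakayama.
Variables (A : comNzRingType) (F K : fieldType).
Variables (ev : {rmorphism A -> F}) (f : {rmorphism A -> K}) (f_inj : injective f).
Variables (V : lmodType K) (S : V -> Prop).
Hypotheses (S0 : S 0) (SD : forall u v, S u -> S v -> S (u + v)).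
Hypotheses (SZ : forall c v, S v -> S (c *: v)).
Variables (J : finType) (z : J -> V).

(** The analogue of S + mZ in Nakayama's lemma, with Z the A-span of the [z l] and m the kernel of
    [ev]. *)
Definition near_span (v : V) : Prop :=
  exists a : J -> A, (forall l, ev (a l) = 0) /\ S (v - \sum_l f (a l) *: z l).

Lemma near_spanD u v : near_span u -> near_span v -> near_span (u + v).
Proof.
move=> [a [a0 Sa]] [b [b0 Sb]]; exists (fun l => a l + b l); split.
  by move=> l; rewrite rmorphD a0 b0 addr0.
have -> : \sum_l f (a l + b l) *: z l
        = \sum_l f (a l) *: z l + \sum_l f (b l) *: z l.
  by rewrite -big_split; apply: eq_bigr => l _; rewrite rmorphD scalerDl.
by rewrite opprD addrACA; apply: SD.
Qed.

Lemma near_spanZ c v : near_span v -> near_span (f c *: v).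
Proof.
move=> [a [a0 Sa]]; exists (fun l => c * a l); split.
  by move=> l; rewrite rmorphM a0 mulr0.
have -> : \sum_l f (c * a l) *: z l = f c *: \sum_l f (a l) *: z l.
  by rewrite scaler_sumr; apply: eq_bigr => l _; rewrite rmorphM scalerA.
by rewrite -scalerBr; apply: SZ.
Qed.

Lemma near_spanS v : S v -> near_span v.
Proof.
move=> Sv; exists (fun=> 0); split=> [l|]; first by rewrite rmorph0.
by rewrite big1 ?subr0 // => l _; rewrite rmorph0 scale0r.
Qed.

Lemma near_span_gen a l : ev a = 0 -> near_span (f a *: z l).
Proof.
move=> a0; exists (fun k => if k == l then a else 0); split=> [k|].
  by case: eqP => _; rewrite ?rmorph0.
rewrite (bigD1 l) //= eqxx big1 ?addr0 ?subrr => [|k /negPf->].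
  exact: S0.
by rewrite rmorph0 scale0r.
Qed.

Lemma near_span_sum (I : finType) (P : pred I) (E : I -> V) :
  (forall i, P i -> near_span (E i)) -> near_span (\sum_(i | P i) E i).
Proof.
move=> nE; elim/big_ind: _ => //; first exact: near_spanS.
exact: near_spanD.
Qed.

(* Modulo S, the z j are solutions of a square linear system over A whose
   determinant does not vanish at the point ev. *)
Lemma near_span_nakayama :
  (forall j, exists2 b, ev b != 0 & near_span (f b *: z j)) -> forall j, S (z j).
Proof.
move=> /fin_all_exists2[b evb /fin_all_exists[a aP]] j.
pose B : 'M[A]_#|J| := \matrix_(i, k)
  (b (enum_val i) *+ (i == k) - a (enum_val i) (enum_val k)).
have detB : f (\det B) != 0.
  apply/negP; rewrite -(rmorph0 f) => /eqP/f_inj/(congr1 ev)/eqP; apply/negP.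
  rewrite rmorph0 -det_map_mx.
  (* At the point the perturbation vanishes and [B] becomes diagonal with nonzero entries, so its
     determinant is nonzero in [A] and, by injectivity of [f], in [K]. *)
  suff -> : map_mx ev B = diag_mx (\row_i ev (b (enum_val i))).
    by rewrite det_diag; apply/prodf_neq0 => i _; rewrite mxE.
  apply/matrixP=> i k; rewrite !mxE rmorphB rmorphMn.
  by have [-> _] := aP (enum_val i); rewrite subr0.
have SB i : S (\sum_k f (B i k) *: z (enum_val k)).
  have [_] := aP (enum_val i); congr S.
  rewrite (reindex (@enum_val J J)) /=; last exact: onW_bij (enum_val_bij J).
  have -> : f (b (enum_val i)) *: z (enum_val i)
      = \sum_k f (b (enum_val i) *+ (i == k)) *: z (enum_val k).
    rewrite (bigD1 i) //= eqxx mulr1n big1 ?addr0 // => k.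
    by rewrite eq_sym => /negPf->; rewrite rmorph0 scale0r.
  by rewrite -sumrB; apply: eq_bigr => k _; rewrite mxE rmorphB scalerBl.
(* Cramer's rule: the adjugate recovers the determinant times [z j] from the relations [SB]. *)
rewrite -[z j](scalerK detB); apply: SZ.
have -> : f (\det B) *: z j
  = \sum_i f (\adj B (enum_rank j) i) *: \sum_k f (B i k) *: z (enum_val k).
  rewrite (eq_bigr (fun i => \sum_k
    f (\adj B (enum_rank j) i * B i k) *: z (enum_val k))); last first.
    by move=> i _; rewrite scaler_sumr; apply: eq_bigr => k _; rewrite rmorphM scalerA.
  rewrite exchange_big /= (bigD1 (enum_rank j)) //= [X in _ + X]big1 ?addr0.
    rewrite -scaler_suml -rmorph_sum; congr (f _ *: _); last by rewrite enum_rankK.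
    by have /matrixP/(_ (enum_rank j) (enum_rank j)) := mul_adj_mx B; rewrite !mxE eqxx mulr1n.
  move=> k kj; rewrite -scaler_suml -rmorph_sum.
  have /matrixP/(_ (enum_rank j) k) := mul_adj_mx B.
  by rewrite !mxE eq_sym (negPf kj) mulr0n => ->; rewrite rmorph0 scale0r.
by elim/big_ind: _ => // i _; apply: SZ.
Qed.
End Nakayama.

(** * Reduction of products to the span of the [d i] and their squares *)

Section Spanning.
Variables (A : comNzRingType) (F K : fieldType).
Variables (ev : {rmorphism A -> F}) (f : {rmorphism A -> K}) (f_inj : injective f).
Variables (U : lalgType K) (n : nat).
Local Notation idx := 'I_n.+1.
Variables (x gap : idx -> idx -> A) (y : idx -> A) (r : K) (d : idx -> U).
Variables (W : U -> Prop) (delta : idx -> K -> K).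

Hypotheses (W0 : W 0) (WD : forall P Q, W P -> W Q -> W (P + Q)).
Hypothesis WM : forall P Q, W Q -> W (P * Q).
Hypothesis dC : forall i j, d i * d j = d j * d i.
Hypothesis dZ : forall i c P, d i * (c *: P) = c *: (d i * P) + delta i c *: P.
Hypothesis delta_x : forall k i j, delta k (f (x i j)) = 0.
Hypothesis delta_r : forall k, delta k (r ^+ 2) = 0.
Hypothesis delta_xx : forall k i j, delta k (f (gap i j)) = 0.
Hypothesis W_sphere : W (\sum_i d i * d i - (r ^+ 2)%:A).
Hypothesis W_rot : forall i j : idx, (i < j)%N ->
  W (f (x i j) *: (d i * d i) + f (gap i j) *: (d i * d j)
     - f (x i j) *: (d j * d j)
     + \sum_(s | (s != i) && (s != j))
         (f (x s j) *: (d i * d s) - f (x i s) *: (d j * d s))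
     + f (y j) *: d i - f (y i) *: d j).
Hypotheses (r_neq0 : r != 0) (ev_x : forall i j, i != j -> ev (x i j) = 0).
Hypothesis ev_xx : forall i j, i != j -> ev (gap i j) != 0.

Definition quadratic_span (v : U) : Prop := exists a b : idx -> K,
  W (v - \sum_i (a i *: d i + b i *: (d i * d i))).
Local Notation S := quadratic_span.

Lemma ideal_scale c v : W v -> W (c *: v).
Proof. by rewrite -const_mull => /WM; apply. Qed.

Lemma quadratic_spanD u v : S u -> S v -> S (u + v).
Proof.
move=> [a [b Wu]] [a' [b' Wv]].
exists (fun i => a i + a' i), (fun i => b i + b' i).
under eq_bigr do rewrite !scalerDl addrACA.
by rewrite big_split opprD addrACA; apply: WD.
Qed.

Lemma quadratic_spanZ c v : S v -> S (c *: v).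
Proof.
move=> [a [b Wv]]; exists (fun i => c * a i), (fun i => c * b i).
under eq_bigr do rewrite -!scalerA -scalerDr.
by rewrite -scaler_sumr -scalerBr; apply: ideal_scale.
Qed.

Lemma quadratic_spanW v : W v -> S v.
Proof.
move=> Wv; exists (fun=> 0), (fun=> 0).
by rewrite big1 ?subr0 // => i _; rewrite !scale0r addr0.
Qed.

Lemma quadratic_span0 : S 0. Proof. exact: quadratic_spanW. Qed.

Lemma quadratic_spanN v : S v -> S (- v).
Proof. by rewrite -scaleN1r; apply: quadratic_spanZ. Qed.

Lemma quadratic_span_sum (I : finType) (P : pred I) (E : I -> U) :
  (forall i, P i -> S (E i)) -> S (\sum_(i | P i) E i).
Proof.
move=> SE; elim/big_ind: _ => //; first exact: quadratic_span0.
exact: quadratic_spanD.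
Qed.

Lemma quadratic_span_d i : S (d i).
Proof.
exists (fun j => (j == i)%:R), (fun=> 0).
rewrite (bigD1 i) //= eqxx scale1r scale0r addr0 big1 ?addr0 ?subrr // => j.
by move=> /negPf->; rewrite !scale0r addr0.
Qed.

Lemma quadratic_span_dd i : S (d i * d i).
Proof.
exists (fun=> 0), (fun j => (j == i)%:R).
rewrite (bigD1 i) //= eqxx scale1r scale0r add0r big1 ?addr0 ?subrr // => j.
by move=> /negPf->; rewrite !scale0r addr0.
Qed.

(** The sphere relation writes [r ^+ 2] as the sum of the squares, and [r] is invertible in [K]. *)
Lemma quadratic_span1 : S 1.
Proof.
rewrite -[1](scalerK (expf_neq0 2 r_neq0)); apply: quadratic_spanZ.
have -> : (r ^+ 2)%:A = \sum_i d i * d i - (\sum_i d i * d i - (r ^+ 2)%:A).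
  by rewrite opprB addrC subrK.
apply: quadratic_spanD.
  by apply: quadratic_span_sum => i _; exact: quadratic_span_dd.
exact/quadratic_spanN/quadratic_spanW.
Qed.

(* Left multiplication by 1 or by some d k turns the rotation relations into
   relations between monomials of degree 2 or 3. *)
Lemma near_rot (u : U) (J : finType) (z : J -> U) (i j : idx) :
  (forall a b P, u * (f (x a b) *: P) = f (x a b) *: (u * P)) ->
  (forall P, u * (f (gap i j) *: P) = f (gap i j) *: (u * P)) ->
  (forall a b, S (u * (f (y a) *: d b))) ->
  (forall a b c e, a != b -> near_span ev f S z (f (x a b) *: (u * (d c * d e)))) ->
  (i < j)%N -> near_span ev f S z (f (gap i j) *: (u * (d i * d j))).
Proof.
move=> ux uxx uy nx ij.
have nij : i != j by rewrite neq_ltn ij.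
have nD P Q : near_span ev f S z P -> near_span ev f S z Q ->
      near_span ev f S z (P + Q).
  by apply: near_spanD; exact: quadratic_spanD.
have nN P : near_span ev f S z P -> near_span ev f S z (- P).
  by move/(near_spanZ quadratic_spanZ) => /(_ (-1)); rewrite rmorphN1 scaleN1r.
have nS P : S P -> near_span ev f S z P.
  exact: near_spanS.
have /quadratic_spanW := WM u (W_rot ij).
rewrite !(mulrDr, mulrN) uxx !ux.
set T1 := f (x i j) *: _; set T2 := f (gap _ _) *: _; set T3 := f (x i j) *: _.
set T4 := u * \sum_(_ | _) _; set T5 := u * _; set T6 := u * _ => SW.
(* The relation is solved for [T2]; every other term lies in [S] or carries an off-diagonal [x]. *)
have -> : T2 = (T1 + T2 - T3 + T4 + T5 - T6) + T6 - T5 - T4 + T3 - T1.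
  by rewrite subrK !addrK subrK [T1 + T2]addrC addrK.
apply: (nD); last by apply/nN/nx.
apply: (nD); last exact: nx.
apply: (nD); last first.
  rewrite /T4 mulr_sumr; apply: (nN).
  apply: near_span_sum => [|P Q|s /andP[si sj]]; first exact: quadratic_span0.
    exact: quadratic_spanD.
  by rewrite mulrBr !ux; apply: (nD); [apply: (nx)|apply/nN/nx; rewrite eq_sym].
by apply: (nD); [apply: (nD); [exact: nS|apply: (nS); exact: uy]|apply/nN/nS/uy].
Qed.

(** Nakayama is applied to all products at once: squares lie in [S] outright, and a mixed product
    comes multiplied by a gap that is nonzero at the point. *)
Lemma quadratic_span_d2 i j : S (d i * d j).
Proof.
pose z (p : idx * idx) := d p.1 * d p.2.
pose nspan := near_span ev f S z.
have nx a b c e : a != b -> nspan (f (x a b) *: (d c * d e)).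
  by move=> ab; exact: (near_span_gen f quadratic_span0 z (c, e) (ev_x ab)).
have near_lt (a b : idx) : (a < b)%N -> nspan (f (gap a b) *: (d a * d b)).
  move=> ab; rewrite -[d a * d b]mul1r; apply: near_rot => //.
  - by move=> *; rewrite !mul1r.
  - by move=> *; rewrite !mul1r.
  - by move=> c e; rewrite mul1r; apply/quadratic_spanZ/quadratic_span_d.
  - by move=> a' b' c e ?; rewrite mul1r; exact: nx.
suff: forall p, S (z p) by move/(_ (i, j)).
apply: (near_span_nakayama f_inj quadratic_span0 quadratic_spanD quadratic_spanZ) => -[a b].
rewrite /z /=; case: (ltngtP a b) => [ab|ba|/val_inj ->].
- exists (gap a b); first by apply: ev_xx; rewrite neq_ltn ab.
  exact: near_lt.
- exists (gap b a); first by apply: ev_xx; rewrite neq_ltn ba.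
  by rewrite dC; exact: near_lt.
- exists 1; first by rewrite rmorph1 oner_eq0.
  rewrite rmorph1 scale1r; apply: near_spanS.
  exact: quadratic_span_dd.
Qed.

(** The same argument on triples, with the rotation relations multiplied by a further [d k]. Moving
    [d k] past a coefficient costs nothing for [x] and [gap], and a term of degree one for [y].
    Since the [d i] commute, only cubes offer no pair of distinct indices; those come from the
    sphere relation. *)
Lemma quadratic_span_d3 k i j : S (d k * (d i * d j)).
Proof.
pose z (p : idx * idx * idx) := d p.1.1 * (d p.1.2 * d p.2).
pose nspan := near_span ev f S z.
have nx a b g c e : a != b -> nspan (f (x a b) *: (d g * (d c * d e))).
  by move=> ab; exact: (near_span_gen f quadratic_span0 z (g, c, e) (ev_x ab)).
have near_lt (g a b : idx) : (a < b)%N ->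
    nspan (f (gap a b) *: (d g * (d a * d b))).
  move=> ab; apply: near_rot => //.
  - by move=> a' b' P; rewrite dZ delta_x scale0r addr0.
  - by move=> P; rewrite dZ delta_xx scale0r addr0.
  - move=> c e; rewrite dZ; apply: quadratic_spanD; apply: quadratic_spanZ.
      exact: quadratic_span_d2.
    exact: quadratic_span_d.
  - by move=> a' b' c e; exact: nx.
have near_neq (g a b : idx) : a != b -> exists2 c, ev c != 0 & nspan (f c *: (d g * (d a * d b))).
  move=> nab; have := nab; rewrite neq_ltn => /orP[ab|ba].
    by exists (gap a b); [exact: ev_xx | exact: near_lt].
  exists (gap b a); first by apply: ev_xx; rewrite eq_sym.
  by rewrite [d a * _]dC; exact: near_lt.
suff: forall p, S (z p) by move/(_ (k, i, j)).
apply: (near_span_nakayama f_inj quadratic_span0 quadratic_spanD quadratic_spanZ) => -[[g a] b].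
rewrite /z /=; have [<-{b}|] := eqVneq a b; last exact: near_neq.
have [->{g}|ga] := eqVneq g a; last first.
  have -> : d g * (d a * d a) = d a * (d g * d a) by rewrite !mulrA [d g * _]dC.
  exact: near_neq.
have /fin_all_exists2[c evc nc] l : exists2 c, ev c != 0 &
    l != a -> nspan (f c *: (d a * (d l * d l))).
  have [->|la] := eqVneq l a; first by exists 1; rewrite ?rmorph1 ?oner_eq0.
  have -> : d a * (d l * d l) = d l * (d a * d l) by rewrite !mulrA [d a * _]dC.
  by have [|c] := near_neq l a l; [rewrite eq_sym | exists c].
(* A common multiplier for all mixed terms [d a * (d l * d l)], each of which needs its own
   [c l]. *)
exists (\prod_l c l); first by rewrite rmorph_prod; apply/prodf_neq0.
have nD P Q : nspan P -> nspan Q -> nspan (P + Q).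
  by apply: near_spanD; exact: quadratic_spanD.
have nZ e P : nspan P -> nspan (f e *: P).
  by apply: near_spanZ; exact: quadratic_spanZ.
(* The sphere relation multiplied by [d a] and solved for the cube. *)
have -> : d a * (d a * d a) = d a * (\sum_l d l * d l - (r ^+ 2)%:A)
    + r ^+ 2 *: d a - \sum_(l | l != a) d a * (d l * d l).
  rewrite mulrBr mulr_sumr (bigD1 a) //= dZ mulr1 delta_r scale0r addr0.
  by rewrite subrK addrK.
rewrite scalerBr -scaleN1r -(rmorphN1 f); apply: (nD).
  apply: (nZ); apply: near_spanS.
  apply: quadratic_spanD; first exact/quadratic_spanW/WM.
  exact/quadratic_spanZ/quadratic_span_d.
apply: (nZ); rewrite scaler_sumr; apply: near_span_sum => [|P Q|l la].
- exact: quadratic_span0.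
- exact: quadratic_spanD.
by rewrite (bigD1 l) //= mulrC rmorphM -scalerA; apply/nZ/nc.
Qed.

Lemma quadratic_span_dmul k v : S v -> S (d k * v).
Proof.
move=> [a [b Wv]].
have -> : d k * v = d k * (v - \sum_i (a i *: d i + b i *: (d i * d i)))
    + \sum_i d k * (a i *: d i + b i *: (d i * d i)).
  by rewrite -mulr_sumr -mulrDr subrK.
apply: quadratic_spanD; first exact/quadratic_spanW/WM.
apply: quadratic_span_sum => i _; rewrite mulrDr !dZ.
apply: quadratic_spanD; apply: quadratic_spanD; apply: quadratic_spanZ.
- exact: quadratic_span_d2.
- exact: quadratic_span_d.
- exact: quadratic_span_d3.
- exact: quadratic_span_dd.
Qed.

(** [D] stands for any partial; as it commutes with the [d i], pushing it to the right reduces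
    [D * v] to [d i * D] and [d i * (d i * D)]. The multiplier [c] is there because the Euler
    operator only gives [r] times the radial partial. *)
Lemma quadratic_span_mul (D : U) (der : K -> K) (c : K) v :
  (forall a P, D * (a *: P) = a *: (D * P) + der a *: P) ->
  (forall i, D * d i = d i * D) ->
  c != 0 -> (forall k, delta k c = 0) -> S (c *: D) -> S v -> S (D * v).
Proof.
move=> DZ Dd c0 dc SD [a [b Wv]].
have SdD i : S (d i * D).
  rewrite -[d i * D](scalerK c0); apply: quadratic_spanZ.
  have -> : c *: (d i * D) = d i * (c *: D) by rewrite dZ dc scale0r addr0.
  exact: quadratic_span_dmul.
have -> : D * v = D * (v - \sum_i (a i *: d i + b i *: (d i * d i)))
    + \sum_i D * (a i *: d i + b i *: (d i * d i)).
  by rewrite -mulr_sumr -mulrDr subrK.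
apply: quadratic_spanD; first exact/quadratic_spanW/WM.
apply: quadratic_span_sum => i _; rewrite mulrDr !DZ.
apply: quadratic_spanD; apply: quadratic_spanD; apply: quadratic_spanZ.
- by rewrite Dd.
- exact: quadratic_span_d.
- by rewrite mulrA Dd -mulrA Dd; apply: quadratic_span_dmul.
- exact: quadratic_span_dd.
Qed.

Lemma quadratic_span_closed : (forall i j, S (d i * d j)) /\
  (forall (D : U) (der : K -> K) (c : K) v,
    (forall a P, D * (a *: P) = a *: (D * P) + der a *: P) ->
    (forall i, D * d i = d i * D) ->
    c != 0 -> (forall k, delta k c = 0) -> S (c *: D) -> S v -> S (D * v)).
Proof.
by split=> [|D der c v DZ Dd c0 dc]; [exact: quadratic_span_d2 |
  exact: quadratic_span_mul DZ Dd c0 dc].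
Qed.

End Spanning.

Lemma diffop_generated (N : nat) (A : comNzRingType) (dA : comm_derivations N A)
    (S : diffop dA -> Prop) :
  (forall P Q, S P -> S Q -> S (P + Q)) -> (forall c P, S P -> S (c *: P)) ->
  S 1 -> (forall i P, S P -> S (partial dA i * P)) -> forall P, S P.
Proof.
move=> SD SZ S1 Sp P.
have S0 : S 0 by rewrite -(scale0r 1); exact: SZ.
rewrite (mpolyE P); elim/big_ind: _ => // m _; apply: SZ.
elim/mnm_ind: m => [|i m IH]; first by rewrite mpolyX0.
by have := Sp i _ IH; rewrite partialE dstep1.
Qed.

(** * Twisted derivatives in one variable *)

Local Notation "a %:F" := (@FracField.tofrac _ a).

(** * Functions with poles along a single denominator *)

Section Localization.
Variables (A : idomainType) (e : A).

(** The ring [A[1/e]] inside the fraction field. *)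
Definition localized (f : {fraction A}) : Prop :=
  exists m g, f * (e ^+ m)%:F = g%:F.

Lemma localized_tofrac a : localized a%:F.
Proof. by exists 0%N, a; rewrite expr0 tofrac1 mulr1. Qed.

Lemma localizedM f g : localized f -> localized g -> localized (f * g).
Proof.
move=> [m [a fa]] [k [b gb]]; exists (m + k)%N, (a * b).
by rewrite exprD !tofracM mulrACA fa gb.
Qed.

Lemma localizedD f g : localized f -> localized g -> localized (f + g).
Proof.
move=> [m [a fa]] [k [b gb]]; exists (m + k)%N, (a * e ^+ k + b * e ^+ m).
rewrite exprD tofracD !tofracM mulrDl mulrA fa; congr (_ + _).
by rewrite [X in g * X]mulrC mulrA gb.
Qed.

Lemma localizedN f : localized f -> localized (- f).
Proof. by move=> [m [a fa]]; exists m, (- a); rewrite mulNr fa tofracN. Qed.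

Hypothesis e_neq0 : e != 0.
Variable D : {additive A -> A}.
Hypothesis DM : forall a b, D (a * b) = D a * b + a * D b.

Lemma localized_der f : localized f -> localized (frac_der D f).
Proof.
move=> [m [a fa]]; exists (m + m)%N, (D a * e ^+ m - a * D (e ^+ m)).
rewrite exprD !tofracM mulrA (frac_derE DM _ fa) ?expf_neq0 //.
by rewrite mulrBl tofracB !tofracM -fa mulrAC.
Qed.

End Localization.

(* Over the zeros of e the twist phi has a pole of order 2, so applying the
   twisted derivation to a function with a pole of order m > 0 yields a pole of
   order m + 2; at infinity the nonzero constant rho keeps the degree. *)
Lemma leibniz_rearrange (L : comNzRingType) (f g q e e' : L) k :
  (g - f * (e' * q *+ k)) * (e * e) = g * (e * e) - f * (q * e) * e' * e *+ k.
Proof. by rewrite mulrBl mulrnAr mulrnAl; congr (_ - _ *+ k); ring. Qed.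

Lemma twist_rearrange (L : comNzRingType) (u v f s t : L) :
  (u + v * f) * s * t = (u * t) * s + (v * s) * (f * t).
Proof. by ring. Qed.

Section TwistedDerivative.
Variables (K : fieldType) (N : nat) (e chi : {poly K}) (rho : K).
Variable phi : {fraction {poly K}}.
Hypotheses (e_monic : e \is monic) (size_e : size e = N.+1).
Hypotheses (size_chi : (size chi <= 2 * N)%N) (e_chi : coprimep e chi).
Hypotheses (rho_neq0 : rho != 0) (phiE : phi * (e ^+ 2)%:F = (rho *: e ^+ 2 + chi)%:F).

Local Notation D := (frac_der (@deriv K)).
Let DM := @derivM K.

(** Descent on the pole order: after clearing denominators every term except [chi * g] is divisible
    by [e], and [chi] is coprime to [e], so a factor [e] cancels from the fraction. *)
Lemma twisted_derivative_polynomial f (h : {poly K}) :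
  localized e f -> (D f + phi * f) * (e ^+ 2)%:F = h%:F -> exists g, f = g%:F.
Proof.
move=> [m [g fg]] fh; elim: m g fg => [|m IH] g fg.
  by exists g; rewrite -fg expr0 tofrac1 mulr1.
have eF : e%:F != 0 by rewrite tofrac_eq0 monic_neq0.
suff /dvdpP[q gq] : e %| g.
  by apply: (IH q); apply: (mulIf eF); rewrite -tofracM -gq -fg exprSr tofracM mulrA.
have em0 : e ^+ m.+1 != 0 by rewrite expf_neq0 // monic_neq0.
have := congr1 (fun u => u * (e ^+ m.+1)%:F) fh.
rewrite twist_rearrange (frac_derE DM em0 fg) phiE fg.
have -> : (g^`()%:F - f * (e ^+ m.+1)^`()%:F) * (e ^+ 2)%:F
    = (g^`() * e ^+ 2 - (g * e^`() * e) *+ m.+1)%:F.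
  rewrite deriv_exp /= !(tofracB, tofracMn, tofracM) -fg !tofracXn ?exprSr ?tofracM ?tofracXn.
  exact: leibniz_rearrange.
rewrite -!tofracM -tofracD => /eqP; rewrite tofrac_eq => /eqP E.
rewrite -(Gauss_dvdpr _ e_chi).
have -> : chi * g = h * e ^+ m.+1
    - (g^`() * e ^+ 2 - g * e^`() * e *+ m.+1 + rho *: e ^+ 2 * g).
  by rewrite -E mulrDl addrA [X in X - _]addrC addrK.
have ee2 q : e %| q * e ^+ 2 by rewrite dvdp_mull // expr2 dvdp_mulr.
apply: dvdp_sub; first by rewrite dvdp_mull // exprS dvdp_mulr.
apply: dvdp_add; last by rewrite -scalerAl mulrC scalerAl ee2.
apply: dvdp_sub; first exact: ee2.
by rewrite -mulrnAl dvdp_mull.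
Qed.

(** The primitive is a polynomial [g] by the previous lemma. If [g] were nonzero, the degree of
    [rho *: (e ^+ 2 * g)] would exceed that of every other term in the equation. *)
Lemma twisted_derivative_neq0 f (h : {poly K}) : localized e f -> (size h <= 2 * N)%N ->
  (D f + phi * f) * (e ^+ 2)%:F = h%:F -> h = 0.
Proof.
move=> ef hN fh; have [g fg] := twisted_derivative_polynomial ef fh.
move: fh; rewrite fg (frac_der_tofrac DM) mulrDl mulrAC phiE -!tofracM -tofracD.
move/eqP; rewrite tofrac_eq => /eqP E.
rewrite /= in E.
have [g0|g0] := eqVneq g 0; first by rewrite -E g0 deriv0 mul0r mulr0 addr0.
have se2 : size (e ^+ 2) = (2 * N).+1.
  by rewrite expr2 size_monicM ?monic_neq0 // size_e mul2n -addnn addnS.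
have e2m : e ^+ 2 \is monic by rewrite rpredX.
have eq1 : rho *: (e ^+ 2 * g) = h - (g^`() * e ^+ 2 + chi * g).
  by rewrite -E mulrDl -scalerAl opprD addrACA subrr add0r addrK.
have sg0 : (0 < size g)%N by rewrite size_poly_gt0.
have /eqP := congr1 (fun p => size (p : {poly K})) eq1.
rewrite /= size_scale // size_monicM // se2 addSn /= gtn_eqF //.
apply: leq_ltn_trans (size_polyD _ _) _; rewrite size_polyN gtn_max.
apply/andP; split; first by rewrite (leq_ltn_trans hN) // -ltn_subLR ?subnn.
apply: leq_ltn_trans (size_polyD _ _) _; rewrite gtn_max; apply/andP; split.
  have [->|g'0] := eqVneq g^`() 0; first by rewrite mul0r size_poly0 addn_gt0 sg0 orbT.
  by rewrite mulrC size_monicM // se2 addSn /= ltn_add2l lt_size_deriv.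
apply: leq_ltn_trans (size_polyMleq _ _) _.
by rewrite -subn1 ltn_subLR ?addn_gt0 ?sg0 ?orbT // add1n ltnS leq_add2r.
Qed.
End TwistedDerivative.

(** * The twist given by the Laplace transform *)

(** Passes from full double sums to sums over ordered pairs: the factor [(i != j).+1] is 1 on the
    diagonal and 2 off it. The same factor is the denominator in [sym_mx]. *)
Lemma sum_symmetric (V : zmodType) (m : nat) (T : 'I_m -> 'I_m -> V) :
  (forall i j, T i j = T j i) ->
  \sum_i \sum_j T i j = \sum_(i : 'I_m) \sum_(j : 'I_m | (i <= j)%N) T i j *+ (i != j).+1.
Proof.
move=> Tsym.
have lhs (i : 'I_m) : \sum_j T i j = T i i + \sum_(j : 'I_m | (i < j)%N) T i j
    + \sum_(j : 'I_m | (j < i)%N) T i j.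
  rewrite (bigID (fun j : 'I_m => (i <= j)%N)) /=; congr (_ + _); last first.
    by apply: eq_bigl => j; rewrite ltnNge.
  rewrite (bigD1 i) //=; congr (_ + _); apply: eq_bigl => j.
  by rewrite ltn_neqAle andbC eq_sym.
have rhs (i : 'I_m) : \sum_(j : 'I_m | (i <= j)%N) T i j *+ (i != j).+1
    = T i i + \sum_(j : 'I_m | (i < j)%N) T i j + \sum_(j : 'I_m | (i < j)%N) T i j.
  rewrite (bigD1 i) //= eqxx mulr1n -addrA -big_split; congr (_ + _).
  apply: eq_big => j; first by rewrite ltn_neqAle andbC eq_sym.
  by case/andP=> _; rewrite eq_sym => ->; rewrite mulr2n.
rewrite (eq_bigr _ (fun i _ => lhs i)) (eq_bigr _ (fun i _ => rhs i)).
rewrite !big_split /=; congr (_ + _).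
rewrite (exchange_big_dep xpredT) //=; apply: eq_bigr => i _.
by apply: eq_bigr => j _; rewrite Tsym.
Qed.

Section Derivation.
Variables (L : fieldType) (D : {additive L -> L}).
Hypothesis DM : forall a b, D (a * b) = D a * b + a * D b.

Lemma derivation1 : D 1 = 0.
Proof. by have /eqP := DM 1 1; rewrite !mulr1 mul1r -subr_eq subrr => /eqP <-. Qed.

Lemma derivation_nat k : D k%:R = 0.
Proof. by rewrite raddfMn /= derivation1 mul0rn. Qed.

Lemma derivationV a : D a^-1 = - D a / a ^+ 2.
Proof.
have [->|a0] := eqVneq a 0; first by rewrite invr0 raddf0 oppr0 mul0r.
have := DM a a^-1; rewrite divff // derivation1 => /eqP.
rewrite eq_sym addr_eq0 => /eqP E; apply: (mulfI a0).
by rewrite -[LHS]opprK -E; field.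
Qed.

Lemma derivation_natVl k b : D (k%:R^-1 * b) = k%:R^-1 * D b.
Proof. by rewrite DM derivationV derivation_nat oppr0 !mul0r add0r. Qed.

(** Obtained by differentiating [B *m G = 1]. *)
Lemma derivation_invmx (m : nat) (B G : 'M[L]_m) : B *m G = 1%:M ->
  map_mx D G = - (G *m map_mx D B *m G).
Proof.
move=> BG; have GB := mulmx1C BG.
have mapM : map_mx D (B *m G) = map_mx D B *m G + B *m map_mx D G.
  apply/matrixP=> i j; rewrite !mxE raddf_sum -big_split.
  by apply: eq_bigr => k _; rewrite !mxE DM.
have map1 : map_mx D 1%:M = 0 :> 'M_m.
  by apply/matrixP=> i j; rewrite !mxE derivation_nat.
have /eqP := mapM; rewrite BG map1 eq_sym addrC addr_eq0 => /eqP E.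
have -> : map_mx D G = G *m (B *m map_mx D G) by rewrite mulmxA GB mul1mx.
by rewrite E mulmxN mulmxA.
Qed.

End Derivation.

(** * Logarithmic derivatives of the Gaussian integrand *)

Section Gauge.
Variables (L : fieldType) (n : nat).
Local Notation idx := 'I_n.+1.
Local Notation var := (option (fb_var n)).
Variables (D : var -> {additive L -> L}) (c : var -> L).
Hypothesis DM : forall v a b, D v (a * b) = D v a * b + a * D v b.
Hypothesis Dc : forall v w, D v (c w) = (v == w)%:R.
Hypothesis two_neq0 : 2 != 0 :> L.

Local Notation vx i j := (Some (inl (inl (sort_pair i j)))).
Local Notation vy i := (Some (inl (inr i))).
Local Notation vr := (Some (inr tt)).
Local Notation vs := None.
Local Notation x i j := (c (vx i j)).
Local Notation y i := (c (vy i)).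
Local Notation r := (c vr).
Local Notation s := (c vs).

Hypothesis r_neq0 : r != 0.

Definition sym_mx : 'M[L]_n.+1 := \matrix_(i, j) (x i j / (i != j).+1%:R).
Definition y_col : 'cV[L]_n.+1 := \col_i y i.

Variable G : 'M[L]_n.+1.
Hypothesis GE : (s%:M - sym_mx) *m G = 1%:M.
Definition eta : 'cV[L]_n.+1 := G *m y_col.
Local Notation e i := (eta i 0).

Lemma sort_pairC i j : sort_pair i j = sort_pair j i :> upper_pair n.
Proof. by apply: val_inj => /=; case: ltngtP => // /val_inj ->. Qed.

Lemma sort_pair_eq (k l i j : idx) : (sort_pair k l == sort_pair i j) =
  (i == k) && (j == l) || (i == l) && (j == k).
Proof.
rewrite -val_eqE /=; case: (leqP k l) => kl; case: (leqP i j) => ij;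
  rewrite xpair_eqE -!(inj_eq val_inj) /=; lia.
Qed.

Lemma upper_pair_sort (p : upper_pair n) : p = sort_pair (val p).1 (val p).2.
Proof. by apply: val_inj => /=; rewrite (valP p) -surjective_pairing. Qed.

Lemma var_ind (P : var -> Prop) :
  (forall k l, P (vx k l)) -> (forall i, P (vy i)) -> P vr -> P vs -> forall v, P v.
Proof. by move=> Px Py Pr Ps [[[p|i]|[]]|] //; rewrite (upper_pair_sort p). Qed.

Lemma sym_mx_sym i j : sym_mx i j = sym_mx j i.
Proof. by rewrite !mxE sort_pairC eq_sym. Qed.

Lemma G_sym i j : G i j = G j i.
Proof.
have tr : (s%:M - sym_mx)^T = s%:M - sym_mx.
  have X_tr : sym_mx^T = sym_mx by apply/matrixP=> a b; rewrite mxE sym_mx_sym.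
  by rewrite linearB /= tr_scalar_mx X_tr.
suff GT : G = G^T by rewrite {1}GT mxE.
have := congr1 trmx GE; rewrite trmx_mul tr trmx1 => GtA.
by rewrite -[LHS]mul1mx -GtA -mulmxA GE mulmx1.
Qed.


Lemma derivation_G v i j : D v (G i j) =
  - \sum_a \sum_b G i a * D v ((s%:M - sym_mx) a b) * G b j.
Proof.
have /matrixP/(_ i j) := derivation_invmx (DM v) GE.
rewrite !mxE => ->; congr (- _).
under eq_bigr do rewrite mxE mulr_suml.
rewrite exchange_big; apply: eq_bigr => a _; apply: eq_bigr => b _.
by rewrite [map_mx _ _ _ _]mxE.
Qed.

Lemma derivation_eta v i : D v (e i) = \sum_k (D v (G i k) * y k + G i k * (v == vy k)%:R).
Proof.
rewrite mxE raddf_sum; apply: eq_bigr => k _.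
by rewrite DM [y_col _ _]mxE Dc.
Qed.

Lemma derivation_A v i j : D v ((s%:M - sym_mx) i j)
  = (v == vs)%:R *+ (i == j) - (v == vx i j)%:R / (i != j).+1%:R.
Proof.
rewrite !mxE raddfB raddfMn /= Dc; congr (_ - _).
by rewrite mulrC (derivation_natVl (DM v)) Dc mulrC.
Qed.

Lemma derivation_G_y k i j : D (vy k) (G i j) = 0.
Proof.
rewrite derivation_G big1 ?oppr0 // => a _; rewrite big1 // => b _.
by rewrite derivation_A mul0rn mul0r subrr mulr0 mul0r.
Qed.

Lemma derivation_G_r i j : D vr (G i j) = 0.
Proof.
rewrite derivation_G big1 ?oppr0 // => a _; rewrite big1 // => b _.
by rewrite derivation_A mul0rn mul0r subrr mulr0 mul0r.
Qed.

Lemma derivation_G_s i j : D vs (G i j) = - \sum_k G i k * G k j.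
Proof.
rewrite derivation_G; congr (- _); apply: eq_bigr => a _.
rewrite (bigD1 a) //= derivation_A eqxx mul0r subr0 mulr1.
rewrite big1 ?addr0 // => b ba.
by rewrite derivation_A [a == b]eq_sym (negPf ba) mul0r subr0 mulr0 mul0r.
Qed.

Lemma derivation_G_x k l i j :
  D (vx k l) (G i j) = (G i k * G l j + G i l * G k j) / 2.
Proof.
have part u v : \sum_a \sum_b G i a * ((a == u) && (b == v))%:R * G b j = G i u * G v j.
  rewrite (bigD1 u) //= (bigD1 v) //= !eqxx mulr1 [X in _ + X + _]big1 => [|b /negPf->].
    rewrite [X in _ + X]big1 ?addr0 // => a /negPf->.
    by rewrite big1 // => b _; rewrite mulr0 mul0r.
  by rewrite mulr0 mul0r.
rewrite derivation_G -!part -big_split mulr_suml -sumrN; apply: eq_bigr => a _.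
rewrite -big_split mulr_suml -sumrN; apply: eq_bigr => b _ /=.
rewrite derivation_A mul0rn sub0r.
have -> : (vx k l == vx a b) = (a == k) && (b == l) || (a == l) && (b == k).
  by rewrite -sort_pair_eq.
(* For [a = b] the two indicators agree, otherwise at most one of them holds; the weight in [sym_mx]
   thus makes the formula uniform in [k = l] and [k != l]. *)
have -> : ((a == k) && (b == l) || (a == l) && (b == k))%:R / (a != b).+1%:R
    = (((a == k) && (b == l))%:R + ((a == l) && (b == k))%:R) / 2 :> L.
  have [<-{b}|ab] := eqVneq a b.
    by rewrite andbC orbb divr1; case: (_ && _) => /=; field.
  case: (boolP ((a == k) && _)) => [/andP[/eqP<- _]|_]; last by rewrite add0r.
  by rewrite [b == a]eq_sym (negPf ab) andbF addr0.
by field.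
Qed.

Lemma derivation_eta_y k i : D (vy k) (e i) = G i k.
Proof.
rewrite derivation_eta (bigD1 k) //= derivation_G_y mul0r add0r eqxx mulr1.
rewrite big1 ?addr0 // => j jk; rewrite derivation_G_y mul0r add0r.
by rewrite -[_ == _]/(k == j) eq_sym (negPf jk) mulr0.
Qed.

Lemma derivation_eta_r i : D vr (e i) = 0.
Proof.
by rewrite derivation_eta big1 // => k _; rewrite derivation_G_r mul0r mulr0 addr0.
Qed.

Lemma etaE i : e i = \sum_k G i k * y k.
Proof. by rewrite mxE; apply: eq_bigr => k _; rewrite mxE. Qed.

Lemma derivation_eta_s i : D vs (e i) = - \sum_k G i k * e k.
Proof.
rewrite derivation_eta; under eq_bigr do rewrite derivation_G_s mulr0 addr0 mulNr mulr_suml.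
rewrite sumrN exchange_big; congr (- _); apply: eq_bigr => k _.
by rewrite etaE mulr_sumr; apply: eq_bigr => l _; rewrite mulrA.
Qed.

Lemma derivation_eta_x k l i : D (vx k l) (e i) = (G i k * e l + G i l * e k) / 2.
Proof.
rewrite derivation_eta !etaE !mulr_sumr -big_split mulr_suml.
apply: eq_bigr => j _ /=; rewrite derivation_G_x mulr0 addr0; by field.
Qed.

(* The logarithmic derivatives of r exp(r^2 s + y^T G y / 4) det(s - X)^(-1/2)
   where G = (s - X)^-1 and eta = G y; v = None stands for s. *)
Definition twist (v : var) : L :=
  match v with
  | Some (inl (inl p)) => e (val p).1 * e (val p).2 / 4 + G (val p).1 (val p).2 / 2
  | Some (inl (inr i)) => e i / 2
  | Some (inr _) => 2 * r * s + r^-1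
  | None => r ^+ 2 - (\sum_i e i ^+ 2) / 4 - (\sum_i G i i) / 2
  end.

Lemma twist_x i j : twist (vx i j) = e i * e j / 4 + G i j / 2.
Proof. by rewrite /=; case: leqP => _ //=; rewrite [e j * _]mulrC G_sym. Qed.

Lemma derivation_div k v a : D v (a / k%:R) = D v a / k%:R.
Proof. by rewrite mulrC (derivation_natVl (DM v)) mulrC. Qed.

Let four_neq0 : 4 != 0 :> L.
Proof. by rewrite -[4%N]/(2 * 2)%N natrM mulf_neq0. Qed.

Lemma derivation_twist_s v : D v (twist vs) =
  D v (r ^+ 2) - (\sum_i e i * D v (e i)) / 2 - (\sum_i D v (G i i)) / 2.
Proof.
rewrite /twist !raddfB /= !derivation_div !raddf_sum.
congr (_ - _ - _); rewrite !mulr_suml; apply: eq_bigr => i _.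
by rewrite expr2 DM; field; rewrite ?four_neq0 ?two_neq0 ?r_neq0.
Qed.

(** The twist is the gradient of the logarithm of the integrand, so mixed derivatives agree. The
    integrand is not assumed to lie in [L], hence the check for each pair of kinds of variables. *)
Lemma twist_closed v w : D v (twist w) = D w (twist v).
Proof.
have xx k l i j : D (vx k l) (twist (vx i j)) = D (vx i j) (twist (vx k l)).
  rewrite !twist_x !raddfD /= !derivation_div !DM !derivation_eta_x !derivation_G_x.
  rewrite [G j k]G_sym [G j l]G_sym [G i k]G_sym [G i l]G_sym.
  by field; rewrite ?four_neq0 ?two_neq0 ?r_neq0.
have xy k l i : D (vx k l) (twist (vy i)) = D (vy i) (twist (vx k l)).
  rewrite !twist_x !raddfD /= !derivation_div !DM !derivation_eta_x.
  rewrite !derivation_eta_y derivation_G_y [G k i]G_sym [G l i]G_sym.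
  by field; rewrite ?four_neq0 ?two_neq0 ?r_neq0.
have xr k l : D (vx k l) (twist vr) = D vr (twist (vx k l)).
  rewrite !twist_x !raddfD /= !derivation_div !DM !derivation_eta_r derivation_G_r.
  rewrite (derivationV (DM _)) !Dc (derivation_nat (DM _)) /=.
  by rewrite oppr0 !(mulr0, mul0r, addr0).
have xs k l : D (vx k l) (twist vs) = D vs (twist (vx k l)).
  rewrite derivation_twist_s expr2 DM Dc mul0r mulr0 addr0 sub0r !twist_x !raddfD /=.
  rewrite !derivation_div DM !derivation_eta_s derivation_G_s.
  under eq_bigr do rewrite derivation_eta_x.
  under [X in _ - X / 2]eq_bigr do rewrite derivation_G_x.
  rewrite !(mulNr, mulrN) !mulr_suml !mulr_sumr -!sumrN -!big_split /= !mulr_suml.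
  rewrite -?sumrN -?big_split /=; apply: eq_bigr => i _.
  by rewrite [G i k]G_sym [G i l]G_sym; field; rewrite ?four_neq0 ?two_neq0.
have yy i j : D (vy i) (twist (vy j)) = D (vy j) (twist (vy i)).
  by rewrite /= !derivation_div !derivation_eta_y G_sym.
have yr i : D (vy i) (twist vr) = D vr (twist (vy i)).
  rewrite /= derivation_div derivation_eta_r raddfD !DM /= (derivationV (DM _)) !Dc.
  by rewrite (derivation_nat (DM _)) /= oppr0 !(mulr0, mul0r, addr0).
have ys i : D (vy i) (twist vs) = D vs (twist (vy i)).
  rewrite derivation_twist_s expr2 DM Dc mul0r mulr0 addr0 sub0r /=.
  rewrite derivation_div derivation_eta_s.
  under eq_bigr do rewrite derivation_eta_y.
  rewrite [X in _ - X / 2]big1 => [|j _]; last exact: derivation_G_y.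
  rewrite mul0r subr0 mulNr; congr (- (_ / _)); apply: eq_bigr => j _.
  by rewrite mulrC G_sym.
have rs : D vr (twist vs) = D vs (twist vr).
  rewrite derivation_twist_s big1 => [|i _]; last by rewrite derivation_eta_r mulr0.
  rewrite big1 => [|i _]; last by rewrite derivation_G_r.
  rewrite /= raddfD /= !DM (derivationV (DM _)) !Dc (derivation_nat (DM _)) /=.
  by field; rewrite ?four_neq0 ?two_neq0 ?r_neq0.
elim/var_ind: v => [k l|i||]; elim/var_ind: w => [k' l'|i'||] //;
  by rewrite ?(xx, xy, xr, xs, yy, yr, ys, rs).
Qed.

(** The derivative of the integrand times [g], divided by the integrand. *)
Definition twisted (v : var) (g : L) : L := D v g + twist v * g.

Fact twisted_is_additive v : zmod_morphism (twisted v).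
Proof. by move=> g h; rewrite /twisted raddfB mulrBr opprD addrACA. Qed.
HB.instance Definition _ v :=
  GRing.isZmodMorphism.Build L L (twisted v) (twisted_is_additive v).

Lemma twistedC v w g : (forall a, D v (D w a) = D w (D v a)) ->
  twisted v (twisted w g) = twisted w (twisted v g).
Proof.
move=> DC; rewrite /twisted !raddfD !DM DC twist_closed /=; ring.
Qed.

Lemma twisted1 v : twisted v 1 = twist v.
Proof. by rewrite /twisted (derivation1 (DM v)) add0r mulr1. Qed.

(** The second derivative of the integrand in [y i] and [y j], divided by the integrand. It equals
    the logarithmic derivative in [x i j], a heat equation. *)
Definition moment i j : L := e i * e j / 4 + G i j / 2.

Lemma twisted_yy i j : twisted (vy i) (twisted (vy j) 1) = moment i j.
Proof.
rewrite twisted1 /twisted /= derivation_div derivation_eta_y G_sym /moment.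
by field; rewrite ?four_neq0 ?two_neq0.
Qed.

Lemma moment_sym i j : moment i j = moment j i.
Proof. by rewrite /moment G_sym [e i * _]mulrC. Qed.

Lemma twisted_xx i j : twisted (vx i j) 1 = moment i j.
Proof. by rewrite twisted1 twist_x. Qed.

(** The sphere relation holds for the integrand only up to the total derivative [twisted vs 1]. *)
Lemma sum_moment : \sum_i moment i i = r ^+ 2 - twisted vs 1.
Proof.
rewrite twisted1 /= /moment big_split /= -!mulr_suml; ring.
Qed.

(** Comes from [(s - X) G = 1] and [(s - X) eta = y]. Its off-diagonal entries give the rotation
    relations, its trace the Euler relation. *)
Lemma sym_mx_moment i j :
  \sum_k sym_mx i k * moment k j = s * moment i j - y i * e j / 4 - (i == j)%:R / 2.
Proof.
have AG : \sum_k (s%:M - sym_mx) i k * G k j = (i == j)%:R.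
  by have /matrixP/(_ i j) := GE; rewrite !mxE.
have Ae : \sum_k (s%:M - sym_mx) i k * e k = y i.
  have : (s%:M - sym_mx) *m eta = y_col by rewrite mulmxA GE mul1mx.
  by move=> /matrixP/(_ i 0); rewrite !mxE.
rewrite -AG -Ae !mulr_suml.
have -> : s * moment i j = \sum_k (s%:M : 'M_n.+1) i k * moment k j.
  rewrite (bigD1 i) //= mxE eqxx big1 ?addr0 // => k ki.
  by rewrite mxE eq_sym (negPf ki) mul0r.
rewrite -!sumrB; apply: eq_bigr => k _; rewrite [(s%:M - _) i k]mxE [(- sym_mx) _ _]mxE /moment.
by field; rewrite ?four_neq0 ?two_neq0.
Qed.

Lemma sym_mx_x i j : x i j = sym_mx i j *+ (i != j).+1.
Proof.
rewrite mxE -[RHS]mulr_natr divfK //.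
by case: (i == j); [exact: oner_neq0 | exact: two_neq0].
Qed.

(** The quadratic part is twice the difference of the (j, i) and (i, j) entries of X times the
    moment matrix. In [sym_mx_moment] the multiple of [s] is symmetric and cancels, and the [y]
    terms cancel the linear part. *)
Lemma moment_rot i j : i != j ->
  x i j * moment i i + 2 * (x j j - x i i) * moment i j - x i j * moment j j
  + \sum_(k | (k != i) && (k != j)) (x k j * moment i k - x i k * moment j k)
  + y j * twist (vy i) - y i * twist (vy j) = 0.
Proof.
move=> ij.
have E := sym_mx_moment j i; have E' := sym_mx_moment i j.
rewrite eq_sym (negPf ij) mul0r subr0 [moment j i]moment_sym in E.
rewrite (negPf ij) mul0r subr0 in E'.
have -> : \sum_(k | (k != i) && (k != j)) (x k j * moment i k - x i k * moment j k)
  = (\sum_(k | (k != i) && (k != j)) (sym_mx j k * moment k i)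
     - \sum_(k | (k != i) && (k != j)) (sym_mx i k * moment k j)) *+ 2.
  rewrite -sumrB -sumrMnl; apply: eq_bigr => k /andP[ki kj].
  rewrite !sym_mx_x kj eq_sym ki sym_mx_sym [moment i k]moment_sym [moment j k]moment_sym.
  by rewrite /=; ring.
have split2 (T : idx -> L) : \sum_k T k = T i + T j + \sum_(k | (k != i) && (k != j)) T k.
  by rewrite (bigD1 i) // (bigD1 j) 1?eq_sym //= addrA.
rewrite !split2 in E E'.
have -> : \sum_(k | (k != i) && (k != j)) sym_mx j k * moment k i =
  s * moment i j - y j * e i / 4 - sym_mx j i * moment i i - sym_mx j j * moment j i.
  by rewrite -E; ring.
have -> : \sum_(k | (k != i) && (k != j)) sym_mx i k * moment k j =
  s * moment i j - y i * e j / 4 - sym_mx i i * moment i j - sym_mx i j * moment j j.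
  by rewrite -E'; ring.
rewrite !sym_mx_x ij !eqxx /= [moment j i]moment_sym [sym_mx j i]sym_mx_sym.
by field; rewrite ?four_neq0 ?two_neq0.
Qed.

(** The quadratic part is minus twice the trace of [sym_mx_moment], into which [sum_moment] brings
    [twisted vs 1]. The explicit terms in [r] and [y] cancel and the constants add up to 2, the
    value of [2 * D vs s]. *)
Lemma moment_euler :
  r * twisted vr 1 - \sum_(i : idx) \sum_(j : idx | (i <= j)%N) 2 * x i j * moment i j
  - \sum_i y i * twist (vy i) - n%:R = 2 * twisted vs s.
Proof.
have -> : \sum_(i : idx) \sum_(j : idx | (i <= j)%N) 2 * x i j * moment i j
    = 2 * \sum_i \sum_j sym_mx i j * moment j i.
  rewrite sum_symmetric => [|i j]; last by rewrite sym_mx_sym moment_sym.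
  rewrite mulr_sumr; apply: eq_bigr => i _; rewrite mulr_sumr; apply: eq_bigr => j _.
  by rewrite sym_mx_x moment_sym -mulrnAl mulrA.
have -> : \sum_i y i * twist (vy i) = (\sum_i y i * e i) / 2.
  by rewrite mulr_suml; apply: eq_bigr => i _; rewrite mulrA.
have -> : \sum_i \sum_j sym_mx i j * moment j i
    = s * (r ^+ 2 - twisted vs 1) - (\sum_i y i * e i) / 4 - n.+1%:R / 2.
  under eq_bigr do rewrite sym_mx_moment eqxx.
  rewrite !sumrB -mulr_sumr sum_moment -!mulr_suml; congr (_ - _ * _).
  by rewrite sumr_const card_ord.
rewrite !twisted1 /twisted Dc eqxx [twist vr]/= -(natr1 n) /=.
set q := \sum_i y i * e i; set p := r ^+ 2 - _ - _.
by field; rewrite ?four_neq0 ?two_neq0 ?r_neq0.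
Qed.

End Gauge.

(** * Specialization of the numerators *)

(** Monic polynomials keep their size under [f], so the Sylvester matrix of the images is the image
    of the Sylvester matrix. *)
Lemma resultant_map (R S : nzRingType) (f : {rmorphism R -> S}) (p q : {poly R}) :
  p \is monic -> q \is monic ->
  f (resultant p q) = resultant (map_poly f p) (map_poly f q).
Proof.
move=> /monicP pm /monicP qm.
have f1 : f 1 != 0 by rewrite rmorph1 oner_neq0.
rewrite /resultant /Sylvester_mx !size_map_poly_id0 ?pm ?qm //.
rewrite -det_map_mx /= map_col_mx; congr (\det (col_mx _ _));
  by apply: map_lin1_mx => v; rewrite map_poly_rV rmorphM /= map_rVpoly.
Qed.

(** * Generic statements deduced from a special point *)

Section Specialization.
Variables (A : comNzRingType) (F K : fieldType).
Variables (ev : {rmorphism A -> F}) (f : {rmorphism A -> K}) (f_inj : injective f).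

Lemma neq0_specialize a : ev a != 0 -> f a != 0.
Proof.
by apply: contraNneq; rewrite -(rmorph0 f) => /f_inj->; rewrite rmorph0.
Qed.

(** For monic polynomials coprimality is the nonvanishing of the resultant, an element of [A]
    compatible with both [ev] and [f]. *)
Lemma coprimep_specialize (p q : {poly A}) : p \is monic -> q \is monic ->
  coprimep (map_poly ev p) (map_poly ev q) -> coprimep (map_poly f p) (map_poly f q).
Proof.
move=> pm qm.
have res (E : fieldType) (g : {rmorphism A -> E}) :
    coprimep (map_poly g p) (map_poly g q) = (g (resultant p q) != 0).
  rewrite (resultant_map g) // resultant_eq0 coprimep_def -leqNgt eqn_leq.
  rewrite lt0n size_poly_eq0 gcdp_eq0 negb_and.
  by rewrite (monic_neq0 (monic_map g pm)) /= andbT.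
by rewrite !res => /neq0_specialize.
Qed.

(** The size bound makes the coefficient matrix square, so freeness at the point says that its
    determinant does not vanish there. *)
Lemma free_specialize (m : nat) (P : 'I_m -> {poly A}) :
  (forall i, (size (P i) <= m)%N) ->
  (forall a : 'I_m -> F, \sum_i a i *: map_poly ev (P i) = 0 -> forall i, a i = 0) ->
  forall a : 'I_m -> K, \sum_i a i *: map_poly f (P i) = 0 -> forall i, a i = 0.
Proof.
move=> sP.
pose B : 'M[A]_m := \matrix_(i, k) (P i)`_k.
have rowE (E : fieldType) (g : {rmorphism A -> E}) (a : 'I_m -> E) :
  (\sum_i a i *: map_poly g (P i) = 0) <-> (\row_i a i *m map_mx g B = 0).
  split=> [E0|E0].
    apply/rowP=> k; rewrite !mxE -[RHS](coef0 _ k) -E0 coef_sum.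
    by apply: eq_bigr => i _; rewrite !mxE coefZ coef_map.
  apply/polyP=> k; rewrite coef0 coef_sum.
  have [km|mk] := ltnP k m; last first.
    have Pk i : (P i)`_k = 0 by rewrite nth_default // (leq_trans (sP i)).
    by rewrite big1 // => i _; rewrite coefZ coef_map Pk raddf0 mulr0.
  have /rowP/(_ (Ordinal km)) := E0; rewrite !mxE => E1; rewrite -[RHS]E1.
  by apply: eq_bigr => i _; rewrite !mxE coefZ coef_map.
move=> evP a /rowE aB i.
have detB : f (\det B) != 0.
  apply: neq0_specialize; rewrite -det_map_mx; apply/negP => /det0P[u u0 uB].
  case/negP: u0; apply/eqP/rowP=> j; rewrite [RHS]mxE.
  apply: (evP (fun j => u 0 j)); apply/rowE.
  by rewrite -[RHS]uB; congr (_ *m _); apply/rowP=> k; rewrite mxE.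
have := congr1 (mulmx^~ (\adj (map_mx f B))) aB.
rewrite -mulmxA mul_mx_adj mul0mx det_map_mx mul_mx_scalar => /rowP/(_ i).
by rewrite !mxE => /eqP; rewrite mulf_eq0 (negPf detB) => /eqP.
Qed.

End Specialization.

(** * Numerators over the square of the characteristic polynomial *)

Section Numerators.
Variables (R : comNzRingType) (n : nat) (X : 'M[R]_n.+1) (y : 'cV[R]_n.+1) (h : R).

Definition num_eta : 'cV[{poly R}]_n.+1 := \adj (char_poly_mx X) *m map_mx polyC y.
Definition pole_coef : {poly R} := \sum_i num_eta i 0 ^+ 2.
(** [num1], [num2] and [twist_num] are the numerators over [char_poly X ^+ 2] of the y-twists, of
    the diagonal moments and of the s-twist without its constant [r ^+ 2]. The parameter [h] stands
    for 1/2, which need not exist in [R]. *)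
Definition num1 i : {poly R} := h *: (num_eta i 0 * char_poly X).
Definition num2 i : {poly R} :=
  (h ^+ 2) *: num_eta i 0 ^+ 2 + h *: (\adj (char_poly_mx X) i i * char_poly X).
Definition twist_num : {poly R} :=
  - ((h ^+ 2) *: pole_coef + h *: ((\sum_i \adj (char_poly_mx X) i i) * char_poly X)).

Lemma size_char_poly_mx i j : (size (char_poly_mx X i j) <= 2)%N.
Proof.
rewrite !mxE; apply: leq_trans (size_polyD _ _) _.
rewrite size_polyN geq_max (leq_trans (size_polyC_leq1 _)) // andbT.
by case: eqP => _; rewrite ?mulr1n ?mulr0n ?size_polyX ?size_poly0.
Qed.

Lemma size_adj i j : (size (\adj (char_poly_mx X) i j) <= n.+1)%N.
Proof.
rewrite mxE /cofactor -signr_odd; set T := \det _.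
suff sT : (size T <= n.+1)%N by case: odd; rewrite ?expr1 ?mulN1r ?size_polyN ?mul1r.
rewrite /T /determinant; apply: leq_trans (size_sum _ _ _) _.
apply/bigmax_leqP => s _; rewrite -signr_odd.
set Q := \prod_(_ < n) _; suff sQ : (size Q <= n.+1)%N.
  by case: odd; rewrite ?expr1 ?mulN1r ?size_polyN ?mul1r.
apply: leq_trans (size_poly_prod_leq _ _) _; rewrite card_ord leq_subLR.
apply: (@leq_trans (\sum_(k < n.+1.-1) 2).+1).
  by rewrite ltnS; apply: leq_sum => k _; rewrite 2!mxE; exact: size_char_poly_mx.
by rewrite sum_nat_const card_ord /=; lia.
Qed.

Lemma size_num_eta i : (size (num_eta i 0%R) <= n.+1)%N.
Proof.
rewrite mxE; apply: leq_trans (size_sum _ _ _) _; apply/bigmax_leqP => k _.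
rewrite [map_mx _ _ _ _]mxE mulrC mul_polyC; apply: leq_trans (size_scale_leq _ _) _.
exact: size_adj.
Qed.

Lemma size_num_eta_sqr i : (size (num_eta i 0%R ^+ 2)%R <= 2 * n.+1)%N.
Proof.
rewrite expr2; apply: leq_trans (size_polyMleq _ _) _.
by have := size_num_eta i; lia.
Qed.

Lemma size_mul_char_poly (p : {poly R}) : (size p <= n.+1)%N ->
  (size (p * char_poly X)%R <= 2 * n.+1)%N.
Proof.
move=> sp; apply: leq_trans (size_polyMleq _ _) _.
by rewrite size_char_poly; lia.
Qed.

Lemma size_num1 i : (size (num1 i) <= 2 * n.+1)%N.
Proof.
exact: leq_trans (size_scale_leq _ _) (size_mul_char_poly (size_num_eta i)).
Qed.

Lemma size_num2 i : (size (num2 i) <= 2 * n.+1)%N.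
Proof.
apply: leq_trans (size_polyD _ _) _; rewrite geq_max.
apply/andP; split; apply: leq_trans (size_scale_leq _ _) _.
  exact: size_num_eta_sqr.
exact/size_mul_char_poly/size_adj.
Qed.

Lemma size_twist_num : (size twist_num <= 2 * n.+1)%N.
Proof.
rewrite size_polyN; apply: leq_trans (size_polyD _ _) _; rewrite geq_max.
apply/andP; split; apply: leq_trans (size_scale_leq _ _) _.
  apply: leq_trans (size_sum _ _ _) _; apply/bigmax_leqP => i _.
  exact: size_num_eta_sqr.
apply: size_mul_char_poly; apply: leq_trans (size_sum _ _ _) _.
by apply/bigmax_leqP => i _; exact: size_adj.
Qed.

(** [coprimep_specialize] asks for monic polynomials; adding the square of [char_poly X] achieves
    this for [pole_coef] and preserves coprimality with [char_poly X]. *)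
Lemma pole_coef_shift_monic : pole_coef + char_poly X ^+ 2 \is monic.
Proof.
have cm : char_poly X ^+ 2 \is monic by rewrite rpredX ?char_poly_monic.
rewrite monicE lead_coefDr ?(monicP cm) //.
rewrite expr2 size_monicM ?monic_neq0 ?char_poly_monic // size_char_poly.
apply: (@leq_ltn_trans (2 * n.+1)); last by lia.
apply: leq_trans (size_sum _ _ _) _.
by apply/bigmax_leqP => i _; exact: size_num_eta_sqr.
Qed.

End Numerators.

Section NumeratorsMap.
Variables (R S : comNzRingType) (g : {rmorphism R -> S}).
Variables (n : nat) (X : 'M[R]_n.+1) (y : 'cV[R]_n.+1) (h : R).

Lemma map_adj_char i j : map_poly g (\adj (char_poly_mx X) i j)
  = \adj (char_poly_mx (map_mx g X)) i j.
Proof. by rewrite -map_char_poly_mx -map_mx_adj [RHS]mxE. Qed.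

Lemma map_num_eta i : map_poly g (num_eta X y i 0)
  = num_eta (map_mx g X) (map_mx g y) i 0.
Proof.
rewrite !mxE rmorph_sum; apply: eq_bigr => k _.
by rewrite rmorphM /= map_adj_char !mxE map_polyC.
Qed.

Lemma map_pole_coef : map_poly g (pole_coef X y) = pole_coef (map_mx g X) (map_mx g y).
Proof.
by rewrite rmorph_sum; apply: eq_bigr => i _; rewrite rmorphXn /= map_num_eta.
Qed.

Lemma map_num1 i : map_poly g (num1 X y h i) = num1 (map_mx g X) (map_mx g y) (g h) i.
Proof. by rewrite map_polyZ rmorphM /= map_num_eta map_char_poly. Qed.

Lemma map_num2 i : map_poly g (num2 X y h i) = num2 (map_mx g X) (map_mx g y) (g h) i.
Proof.
rewrite rmorphD /= !map_polyZ !rmorphXn rmorphM /=.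
by rewrite map_num_eta map_char_poly map_adj_char.
Qed.

End NumeratorsMap.

(** * The point with X diagonal and y = (1, ..., 1) *)

Section DiagonalPoint.
Variables (F : fieldType) (n : nat) (l : 'I_n.+1 -> F).
Hypothesis l_inj : injective l.
Variable h : F.
Hypothesis h_neq0 : h != 0.

Local Notation X := (diag_mx (\row_i l i)).
Local Notation y := (const_mx 1 : 'cV[F]_n.+1).

Definition lagrange i : {poly F} := \prod_(j | j != i) ('X - (l j)%:P).

Lemma char_poly_diag : char_poly X = \prod_i ('X - (l i)%:P).
Proof.
rewrite char_poly_trig ?diag_mx_is_trig //.
by apply: eq_bigr => i _; rewrite !mxE eqxx mulr1n.
Qed.

Lemma adj_diag i j : \adj (char_poly_mx X) i j = lagrange i *+ (i == j).
Proof.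
have Xi : 'X - (l i)%:P != 0 by rewrite polyXsubC_eq0.
apply: (mulfI Xi).
have /matrixP/(_ i j) := mul_mx_adj (char_poly_mx X).
rewrite [in LHS]mxE (bigD1 i) //= big1 ?addr0 => [|k ki]; last first.
  by rewrite !mxE eq_sym (negPf ki) !mulr0n subr0 mul0r.
have -> : char_poly_mx X i i = 'X - (l i)%:P by rewrite !mxE eqxx !mulr1n.
move=> ->; rewrite -[\det _]/(char_poly X) char_poly_diag mxE (bigD1 i) //=.
by rewrite mulrnAr.
Qed.

Lemma num_eta_diag i : num_eta X y i 0 = lagrange i.
Proof.
rewrite mxE (bigD1 i) //= big1 ?addr0 => [|k ki].
  by rewrite adj_diag eqxx mulr1n !mxE mulr1.
by rewrite adj_diag eq_sym (negPf ki) mul0r.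
Qed.

Lemma lagrange_eval i j : (lagrange i).[l j] = (lagrange i).[l i] *+ (i == j).
Proof.
have [<-|ij] := eqVneq i j; first by rewrite mulr1n.
rewrite /lagrange horner_prod (bigD1 j) 1?eq_sym //=.
by rewrite hornerXsubC subrr mul0r.
Qed.

Lemma lagrange_neq0 i : (lagrange i).[l i] != 0.
Proof.
rewrite horner_prod; apply/prodf_neq0 => j ji.
by rewrite hornerXsubC subr_eq0 (inj_eq l_inj) eq_sym.
Qed.

Lemma char_poly_eval i : (char_poly X).[l i] = 0.
Proof. by rewrite char_poly_diag horner_prod (bigD1 i) //= hornerXsubC subrr mul0r. Qed.

(** At the root [l i] only the i-th square in [pole_coef] survives, and it is nonzero as the [l j]
    are distinct. *)
Lemma coprimep_diag : coprimep (char_poly X) (pole_coef X y + char_poly X ^+ 2).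
Proof.
rewrite [X in coprimep X _]char_poly_diag; elim/big_ind: _ => [|p q|i _].
- exact: coprime1p.
- by rewrite coprimepMl => -> ->.
rewrite coprimep_sym coprimep_XsubC rootE hornerD horner_exp char_poly_eval.
rewrite expr0n addr0 /pole_coef horner_sum (bigD1 i) //= big1 ?addr0 => [|j ji].
  by rewrite num_eta_diag horner_exp expf_neq0 ?lagrange_neq0.
by rewrite num_eta_diag horner_exp lagrange_eval (negPf ji) expr0n.
Qed.

(** At [l i] every [num1] vanishes, having the factor [char_poly X], and only the i-th [num2]
    survives: this gives [b i = 0]. Dividing by [char_poly X] and evaluating again gives
    [a i = 0]. *)
Lemma free_diag (a b : 'I_n.+1 -> F) :
  \sum_i (a i *: num1 X y h i + b i *: num2 X y h i) = 0 ->
  (forall i, a i = 0) /\ (forall i, b i = 0).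
Proof.
move=> E.
have b0 i : b i = 0.
  have := congr1 (horner^~ (l i)) E; rewrite horner_sum horner0 (bigD1 i) //=.
  rewrite big1 ?addr0 => [|j ji].
    rewrite hornerD !hornerZ /num1 /num2 hornerD !hornerZ !hornerM char_poly_eval.
    rewrite !mulr0 add0r addr0 num_eta_diag => /eqP.
    rewrite !mulf_eq0 (negPf h_neq0) (negPf (lagrange_neq0 i)).
    by rewrite !orbF => /eqP.
  rewrite hornerD !hornerZ /num1 /num2 hornerD !hornerZ !hornerM char_poly_eval.
  by rewrite num_eta_diag lagrange_eval (negPf ji) ?mulr0n !(mulr0, mul0r, addr0).
split=> // i; move: E.
under eq_bigr do rewrite b0 scale0r addr0 /num1 num_eta_diag scalerA scalerAl.
rewrite -mulr_suml => /eqP; rewrite mulf_eq0 (negPf (monic_neq0 (char_poly_monic _))) orbF.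
move=> /eqP/(congr1 (horner^~ (l i))); rewrite horner_sum horner0 (bigD1 i) //=.
rewrite big1 ?addr0 => [|j ji].
  rewrite hornerZ => /eqP; rewrite !mulf_eq0 (negPf h_neq0) (negPf (lagrange_neq0 i)).
  by rewrite !orbF => /eqP.
by rewrite hornerZ lagrange_eval (negPf ji) mulr0.
Qed.

End DiagonalPoint.

(** * The ideal over the field of rational functions *)

Section LeftIdeal.
Variables (R : nzRingType) (S : R -> Prop).

Lemma left_ideal_gen_incl P : S P -> left_ideal_gen S P.
Proof.
move=> SP; exists 1%N, (fun=> 1), (fun=> P); split=> //.
by rewrite big_ord1 mul1r.
Qed.

Lemma left_ideal_gen0 : left_ideal_gen S 0.
Proof.
by exists 0%N, (fun=> 0), (fun=> 0); split=> [[]//|]; rewrite big_ord0.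
Qed.

Lemma left_ideal_genD P Q :
  left_ideal_gen S P -> left_ideal_gen S Q -> left_ideal_gen S (P + Q).
Proof.
move=> [m [a [g [Sg ->]]]] [k [b [u [Su ->]]]].
exists (m + k)%N.
exists (fun i => match split i with inl j => a j | inr j => b j end).
exists (fun i => match split i with inl j => g j | inr j => u j end).
split=> [i|]; first by case: (split i).
rewrite big_split_ord; congr (_ + _); apply: eq_bigr => i _.
  by rewrite (unsplitK (inl i)).
by rewrite (unsplitK (inr i)).
Qed.

Lemma left_ideal_genM P Q : left_ideal_gen S Q -> left_ideal_gen S (P * Q).
Proof.
move=> [m [a [g [Sg ->]]]]; exists m, (fun i => P * a i), g; split=> //.
by rewrite mulr_sumr; apply: eq_bigr => i _; rewrite mulrA.
Qed.

Lemma left_ideal_gen_min (E : R -> Prop) :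
  E 0 -> (forall P Q, E P -> E Q -> E (P + Q)) -> (forall P Q, S Q -> E (P * Q)) ->
  forall P, left_ideal_gen S P -> E P.
Proof.
move=> E0 ED EM P [m [a [g [Sg ->]]]].
by elim/big_ind: _ => // i _; apply: EM.
Qed.

End LeftIdeal.

(** * Spanning over the field of rational functions *)

Section RationalIdeal.
Variables (F : fieldType) (n : nat).
Hypothesis charF : [pchar F] =i pred0.
Local Notation idx := 'I_n.+1.
Local Notation M := #|{: fb_var n}|.
Local Notation A := {mpoly F[M]}.
Local Notation K := {fraction A}.
Local Notation U := (rat_weyl F M).
Local Notation vx i j := (inl (inl (sort_pair i j))).
Local Notation vy i := (inl (inr i)).
Local Notation vr := (inr tt).
Local Notation d i := (rat_partial F (vy i)).

Definition rat_ideal : U -> Prop := left_ideal_gen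
  (fun Q : U => exists2 P, fisher_bingham_ideal P & Q = weyl_to_rat P).

Lemma rat_ideal_gen P : fb_generator P -> rat_ideal (weyl_to_rat P).
Proof. by move=> gP; apply: left_ideal_gen_incl; exists P => //; exact: left_ideal_gen_incl. Qed.

(** Flattens the two levels of generation, so that only left multiples of the images of the
    Fisher-Bingham generators have to be tested. *)
Lemma rat_ideal_min (E : U -> Prop) :
  E 0 -> (forall P Q, E P -> E Q -> E (P + Q)) ->
  (forall P Q, fb_generator Q -> E (P * weyl_to_rat Q)) ->
  forall P, rat_ideal P -> E P.
Proof.
move=> E0 ED EM; apply: left_ideal_gen_min => // P _ [Q [m [a [g [gP ->]]]] ->].
rewrite rmorph_sum mulr_sumr; elim/big_ind: _ => // i _.
by rewrite rmorphM mulrA; apply: EM.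
Qed.

(** The diagonal values 0, ..., n are distinct in characteristic zero, which keeps every [gap i j]
    with [i != j] nonzero. *)
Definition point (v : fb_var n) : F :=
  match v with
  | inl (inl p) => if (val p).1 == (val p).2 then (val p).1%:R else 0
  | inl (inr _) => 1
  | inr _ => 0
  end.

Definition ev_point : {rmorphism A -> F} := meval (fun i => point (enum_val i)).

Lemma ev_coord (v : fb_var n) : ev_point (poly_coord F v) = point v.
Proof. by rewrite /= /poly_coord mevalXU enum_rankK. Qed.

Lemma point_x i j : point (vx i j) = if i == j then i%:R else 0.
Proof.
rewrite /=; case: (leqP i j) => _ /=; first by [].
by rewrite eq_sym; case: eqP => // ->.
Qed.

Definition gap (i j : idx) : A := 2 * (poly_coord F (vx j j) - poly_coord F (vx i i)).

Lemma nat_inj i j : i%:R = j%:R :> F -> i = j.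
Proof.
have inj0 k : k%:R = 0 :> F -> k = 0%N.
  by move/eqP; have /pcharf0P -> := charF => /eqP.
wlog ij : i j / (i <= j)%N => [H E|/esym/eqP].
  by case: (leqP i j) => [|/ltnW] /H H'; [exact: H'|apply/esym/H'].
rewrite -subr_eq0 -natrB // => /eqP/inj0/eqP; rewrite subn_eq0 => ji.
by apply/eqP; rewrite eqn_leq ij.
Qed.

Lemma ev_gap i j : i != j -> ev_point (gap i j) != 0.
Proof.
move=> ij; rewrite /gap rmorphM rmorphB rmorph_nat !ev_coord !point_x !eqxx.
rewrite mulf_neq0 //; first by have /pcharf0P -> := charF.
by rewrite subr_eq0; apply: contra ij => /eqP/nat_inj/val_inj->.
Qed.

Local Notation tof := (@FracField.tofrac A).
Local Notation dK := (frac_ders (poly_der F M)).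

Lemma tofrac_injective : injective tof.
Proof. by move=> a b /eqP; rewrite tofrac_eq => /eqP. Qed.

Lemma dK_coord (v w : fb_var n) : dK (enum_rank v) (rat_coord F w) = (v == w)%:R.
Proof.
rewrite /= (frac_der_tofrac (derM (poly_der F M) _)) /= mderivX mnm1E.
rewrite (inj_eq enum_rank_inj) eq_sym; case: eqP => [->|_]; last by rewrite scale0r tofrac0.
rewrite scale1r; have -> : (U_(enum_rank w) - U_(enum_rank w))%MM = 0%MM.
  by apply/mnmP => k; rewrite mnmBE mnm0E subnn.
by rewrite mpolyX0 tofrac1.
Qed.

Lemma dKD v a b : dK v (a + b) = dK v a + dK v b.
Proof. exact: raddfD. Qed.

Lemma dKB v a b : dK v (a - b) = dK v a - dK v b.
Proof. exact: raddfB. Qed.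

Lemma dKM v a b : dK v (a * b) = dK v a * b + a * dK v b.
Proof. exact: derM. Qed.

Lemma partial_scale (v : fb_var n) a (P : U) :
  rat_partial F v * (a *: P) = a *: (rat_partial F v * P) + dK (enum_rank v) a *: P.
Proof. by rewrite /rat_partial !partialE dstepZ. Qed.

Local Notation S := (quadratic_span (fun i => d i) rat_ideal).

Lemma rat_idealD P Q : rat_ideal P -> rat_ideal Q -> rat_ideal (P + Q).
Proof. exact: left_ideal_genD. Qed.

Lemma rat_idealM P Q : rat_ideal Q -> rat_ideal (P * Q).
Proof. exact: left_ideal_genM. Qed.

Lemma rat_ideal0 : rat_ideal 0.
Proof. exact: left_ideal_gen0. Qed.

Lemma rat_sphere : rat_ideal (\sum_i d i * d i - (rat_coord F vr ^+ 2)%:A).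
Proof.
by rewrite -weyl_to_rat_sphere; apply: rat_ideal_gen; apply: Or42.
Qed.

Lemma tofrac_gap i j :
  tof (gap i j) = 2 * (rat_coord F (vx j j) - rat_coord F (vx i i)).
Proof. by rewrite /gap rmorphM rmorphB rmorph_nat. Qed.

Lemma rat_rot (i j : idx) : (i < j)%N -> rat_ideal
  (tof (poly_coord F (vx i j)) *: (d i * d i) + tof (gap i j) *: (d i * d j)
  - tof (poly_coord F (vx i j)) *: (d j * d j)
  + \sum_(s | (s != i) && (s != j))
     (tof (poly_coord F (vx s j)) *: (d i * d s) - tof (poly_coord F (vx i s)) *: (d j * d s))
  + tof (poly_coord F (vy j)) *: d i - tof (poly_coord F (vy i)) *: d j).
Proof.
move=> ij; rewrite tofrac_gap.
have := rat_ideal_gen (Or43 _ _ _ (ex_intro _ i (ex_intro _ j (conj ij erefl)))).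
by rewrite weyl_to_rat_rot.
Qed.

Lemma rat_coord_neq0 (v : fb_var n) : rat_coord F v != 0.
Proof. by rewrite tofrac_eq0 -msupp_eq0 msuppX. Qed.

Lemma rat_span_closed : (forall i j, S (d i * d j)) /\
  (forall (v : fb_var n) (c : K) P, c != 0 -> (forall k, dK (enum_rank (vy k)) c = 0) ->
    S (c *: rat_partial F v) -> S P -> S (rat_partial F v * P)).
Proof.
have := @quadratic_span_closed A F K ev_point tof tofrac_injective U n
  (fun i j => poly_coord F (vx i j)) gap (fun i => poly_coord F (vy i))
  (rat_coord F vr) (fun i => d i) rat_ideal (fun i => dK (enum_rank (vy i)))
  rat_ideal0 rat_idealD rat_idealM.
case.
- by move=> i j; rewrite /rat_partial partial_comm.
- by move=> i c P; rewrite partial_scale.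
- by move=> k i j; rewrite dK_coord.
- by move=> k; rewrite expr2 dKM dK_coord mulr0 mul0r addr0.
- move=> k i j.
  suff : dK (enum_rank (vy k)) (2 * (rat_coord F (vx j j) - rat_coord F (vx i i))) = 0.
    by rewrite -tofrac_gap.
  rewrite dKM dKB !dK_coord subr0 mulr0 addr0.
  by rewrite -[2]/(1 + 1) dKD (derivation1 (dKM _)) addr0 mul0r.
- exact: rat_sphere.
- exact: rat_rot.
- by move=> i j ij; rewrite ev_coord point_x (negPf ij).
- exact: ev_gap.
move=> S2 Smul; split=> // v c P c0 dc; apply: (Smul _ (dK (enum_rank v))) => //.
  by move=> a Q; rewrite partial_scale.
by move=> i; rewrite /rat_partial partial_comm.
Qed.

(** The multiplier [c] is 1 except for the radial partial, where the Euler operator dictates [r];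
    the generators [fb_gen_xx] trade a matrix partial for [d i * d j]. *)
Lemma rat_span_partial (v : fb_var n) (P : U) : S P -> S (rat_partial F v * P).
Proof.
have SD := @quadratic_spanD K U n (fun i => d i) rat_ideal rat_idealD.
have SZ := @quadratic_spanZ K U n (fun i => d i) rat_ideal rat_idealM.
have SW := @quadratic_spanW K U n (fun i => d i) rat_ideal.
have S1 : S 1 := quadratic_span1 rat_ideal0 rat_idealD rat_idealM rat_sphere (rat_coord_neq0 _).
have Sd := @quadratic_span_d K U n (fun i => d i) rat_ideal rat_ideal0.
have [S2 Smul] := rat_span_closed.
have Ssum := @quadratic_span_sum K U n (fun i => d i) rat_ideal rat_ideal0 rat_idealD.
have d1 k : dK k 1 = 0 by exact: derivation1 (dKM k).
case: v => [[p|i]|[]].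
- apply: (Smul _ 1); rewrite ?oner_neq0 // scale1r (upper_pair_sort p).
  set i := (val p).1; set j := (val p).2.
  rewrite -[rat_partial F _](subrK (d i * d j)); apply: SD => //; apply: SW.
  rewrite -weyl_to_rat_xx; apply: rat_ideal_gen; apply: Or41.
  by exists i, j; split=> //; exact: (valP p).
- by apply: (Smul _ 1); rewrite ?oner_neq0 // scale1r.
- apply: (Smul _ (rat_coord F vr)); first exact: rat_coord_neq0.
    by move=> k; rewrite dK_coord.
  have /SW := rat_ideal_gen (Or44 _ _ _ (erefl (fb_gen_euler F n))).
  rewrite weyl_to_rat_euler.
  set Q1 := _ *: _; set Q2 := \sum_i _; set Q3 := \sum_i _; set Q4 := _%:A => Se.
  rewrite -/Q1.
  have -> : Q1 = Q1 - Q2 - Q3 - Q4 + Q4 + Q3 + Q2 by rewrite !subrK.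
  apply: (SD); last first.
    by apply: (Ssum) => i _; apply: (Ssum) => j _; apply: (SZ).
  apply: (SD); last by apply: (Ssum) => i _; apply: (SZ).
  by apply: (SD) => //; apply: (SZ).
Qed.

Lemma rat_span (P : U) : S P.
Proof.
apply: diffop_generated.
- exact: (@quadratic_spanD K U n (fun i => d i) rat_ideal rat_idealD).
- exact: (@quadratic_spanZ K U n (fun i => d i) rat_ideal rat_idealM).
- exact: quadratic_span1 rat_ideal0 rat_idealD rat_idealM rat_sphere (rat_coord_neq0 _).
- by move=> i Q; rewrite -(enum_valK i); exact: rat_span_partial.
Qed.

End RationalIdeal.

(** * Periods *)

Section Cohomology.
Variables (K : fieldType) (n : nat).
Local Notation idx := 'I_n.+1.
Local Notation M := #|{: fb_var n}|.
Variables (dK : comm_derivations M K) (xc : fb_var n -> K).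
Hypothesis dxc : forall v w, dK (enum_rank v) (xc w) = (v == w)%:R.
Hypothesis two_neq0 : 2 != 0 :> K.

Local Notation vx i j := (inl (inl (sort_pair i j))).
Local Notation vy i := (inl (inr i)).
Local Notation vr := (inr tt).
Hypothesis r_neq0 : xc vr != 0.

Local Notation P := {poly K}.
Local Notation L := {fraction P}.
Local Notation var := (option (fb_var n)).

Definition der_index (v : var) : 'I_M.+1 :=
  if v is Some w then lift ord0 (enum_rank w) else ord0.
Definition derL (v : var) : {additive L -> L} := frac_ders (poly_ders dK) (der_index v).
Definition frac_const (a : K) : L := a%:P%:F.
Definition coordL (v : var) : L := if v is Some w then frac_const (xc w) else 'X%:F.

Lemma frac_constM a b : frac_const (a * b) = frac_const a * frac_const b.
Proof. by rewrite /frac_const polyCM tofracM. Qed.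
Lemma const_zmod_morphism : zmod_morphism frac_const.
Proof. by move=> a b; rewrite /frac_const polyCB tofracB. Qed.
Lemma const_monoid_morphism : monoid_morphism frac_const.
Proof. by split; [rewrite /frac_const tofrac1 | exact: frac_constM]. Qed.
HB.instance Definition _ := GRing.isZmodMorphism.Build K L frac_const const_zmod_morphism.
HB.instance Definition _ := GRing.isMonoidMorphism.Build K L frac_const const_monoid_morphism.

Lemma derLM v a b : derL v (a * b) = derL v a * b + a * derL v b.
Proof. exact: derM. Qed.

Lemma derLC v w a : derL v (derL w a) = derL w (derL v a).
Proof. exact: derC. Qed.

Lemma derL_tofrac v p : derL v p%:F = (poly_ders_fun dK (der_index v) p)%:F.
Proof. exact: (frac_der_tofrac (derM (poly_ders dK) _)). Qed.

Lemma derL_const v a : derL (Some v) (frac_const a) = frac_const (dK (enum_rank v) a).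
Proof.
rewrite /frac_const derL_tofrac /poly_ders_fun /= liftK; congr (_%:F).
apply/polyP=> k; rewrite coef_derE !coefC; case: eqP => // _; exact: raddf0.
Qed.

Lemma derLs_tofrac p : derL None p%:F = p^`()%:F.
Proof. by rewrite derL_tofrac /poly_ders_fun /= unlift_none. Qed.

Lemma derLs_const a : derL None (frac_const a) = 0.
Proof. by rewrite derLs_tofrac derivC tofrac0. Qed.

Lemma derL_coord v w : derL v (coordL w) = (v == w)%:R.
Proof.
case: w => [w|]; case: v => [v|]; rewrite /coordL.
- by rewrite derL_const dxc /frac_const; case: eqP => [->|vw];
    rewrite ?eqxx ?tofrac1 ?tofrac0 //; case: eqP => // -[].
- exact: derLs_const.
- rewrite derL_tofrac /poly_ders_fun /= liftK -[RHS]tofrac0; congr (_%:F).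
  apply/polyP=> k; rewrite coef_derE coefX coef0.
  by rewrite (derivation_nat (derM dK _)).
- by rewrite derLs_tofrac derivX tofrac1.
Qed.

Lemma const_eq0 a : (frac_const a == 0) = (a == 0).
Proof. by rewrite /frac_const tofrac_eq0 polyC_eq0. Qed.

Lemma two_neq0_frac : 2 != 0 :> L.
Proof. by rewrite -(rmorph_nat frac_const) const_eq0. Qed.

Lemma coordL_r_neq0 : coordL (Some vr) != 0.
Proof. by rewrite /= const_eq0. Qed.

Definition quad_mx : 'M[K]_n.+1 := \matrix_(i, j) (xc (vx i j) / (i != j).+1%:R).
Definition lin_col : 'cV[K]_n.+1 := \col_i xc (vy i).

Local Notation Delta := (char_poly quad_mx).

(** The inverse of s - X by Cramer's rule, with poles only at the zeros of [Delta]. *)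
Definition resolvent : 'M[L]_n.+1 :=
  (Delta%:F)^-1 *: map_mx (@FracField.tofrac P) (\adj (char_poly_mx quad_mx)).

Lemma Delta_neq0 : Delta%:F != 0.
Proof. by rewrite tofrac_eq0 monic_neq0 // char_poly_monic. Qed.

Lemma resolventE : ((coordL None)%:M - sym_mx coordL) *m resolvent = 1%:M.
Proof.
have -> : (coordL None)%:M - sym_mx coordL = map_mx (@FracField.tofrac P) (char_poly_mx quad_mx).
  apply/matrixP=> i j; rewrite !mxE tofracB tofracMn; congr (_ - _).
  by rewrite -/(frac_const _) fmorph_div /= rmorph_nat.
rewrite -scalemxAr -map_mxM mul_mx_adj map_scalar_mx scale_scalar_mx.
by rewrite mulVf ?Delta_neq0.
Qed.

Local Notation T := (twisted derL coordL resolvent).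
Local Notation tw := (twist coordL resolvent).
Local Notation mom := (moment coordL resolvent).
Local Notation e i := (eta coordL resolvent i 0).

Lemma resolvent_num i j : resolvent i j * Delta%:F = (\adj (char_poly_mx quad_mx) i j)%:F.
Proof. by rewrite mxE [map_mx _ _ _ _]mxE mulrC mulVKf // Delta_neq0. Qed.

Lemma eta_num i : e i * Delta%:F = (num_eta quad_mx lin_col i 0)%:F.
Proof.
have -> : num_eta quad_mx lin_col i 0
    = \sum_k \adj (char_poly_mx quad_mx) i k * (xc (vy k))%:P.
  by rewrite mxE; apply: eq_bigr => k _; rewrite [map_mx _ _ _ _]mxE [lin_col _ _]mxE.
rewrite etaE mulr_suml [RHS]rmorph_sum; apply: eq_bigr => k _ /=.
by rewrite tofracM mulrAC resolvent_num.
Qed.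

Lemma const_natV k : frac_const k%:R^-1 = k%:R^-1.
Proof. by rewrite fmorphV /= rmorph_nat. Qed.

Lemma const_mul_poly a p : frac_const a * p%:F = (a *: p)%:F.
Proof. by rewrite -mul_polyC tofracM. Qed.

Lemma square_pole (a g q : L) :
  (a ^+ 2 / 4 + g / 2) * q ^+ 2 = 2^-1 ^+ 2 * (a * q) ^+ 2 + 2^-1 * (g * q * q).
Proof.
have -> : 4 = 2 * 2 :> L by rewrite -natrM.
by rewrite invfM; ring.
Qed.

Lemma simple_pole (a q : L) : a / 2 * q ^+ 2 = 2^-1 * (a * q * q).
Proof. by ring. Qed.

Lemma tw_num i : tw (Some (vy i)) * (Delta ^+ 2)%:F
  = (num1 quad_mx lin_col 2^-1 i)%:F.
Proof.
rewrite /num1 -const_mul_poly const_natV tofracXn tofracM -eta_num.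
exact: simple_pole.
Qed.

Lemma mom_num i : mom i i * (Delta ^+ 2)%:F = (num2 quad_mx lin_col 2^-1 i)%:F.
Proof.
rewrite /num2 tofracD -!const_mul_poly (rmorphXn frac_const) /= const_natV !tofracXn tofracM.
rewrite -eta_num -resolvent_num; exact: square_pole.
Qed.

Lemma tws_num : tw None * (Delta ^+ 2)%:F
  = (xc vr ^+ 2 *: Delta ^+ 2 + twist_num quad_mx lin_col 2^-1)%:F.
Proof.
rewrite tofracD -const_mul_poly (rmorphXn frac_const) /= -/(coordL (Some vr)).
have -> : (twist_num quad_mx lin_col 2^-1)%:F = - \sum_i (num2 quad_mx lin_col 2^-1 i)%:F.
  rewrite -rmorph_sum /= -tofracN; congr (_%:F); rewrite /twist_num /pole_coef.
  by rewrite big_split /= -scaler_sumr -scaler_sumr mulr_suml.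
rewrite (eq_bigr _ (fun i _ => esym (mom_num i))).
rewrite -mulr_suml (sum_moment coordL derLM resolvent) (twisted1 coordL derLM) -mulrBl subKr.
by [].
Qed.

Lemma localized_const a : localized Delta (frac_const a).
Proof. exact: localized_tofrac. Qed.

Lemma localized_nat k : localized Delta k%:R^-1.
Proof. by rewrite -const_natV; exact: localized_const. Qed.

Lemma localized_G i j : localized Delta (resolvent i j).
Proof. by exists 1%N, (\adj (char_poly_mx quad_mx) i j); rewrite expr1 resolvent_num. Qed.

Lemma localized_eta i : localized Delta (e i).
Proof. by exists 1%N, (num_eta quad_mx lin_col i 0); rewrite expr1 eta_num. Qed.

Lemma localized_mom i j : localized Delta (mom i j).
Proof.
by apply: localizedD; apply: localizedM (localized_nat _);
  [apply: localizedM; exact: localized_eta | exact: localized_G].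
Qed.

Lemma localized_tw v : localized Delta (tw v).
Proof.
case: v => [[[p|i]|[]]|].
- exact: localized_mom.
- exact: localizedM (localized_eta i) (localized_nat 2).
- have -> : tw (Some vr) = frac_const 2 * coordL (Some vr) * 'X%:F + frac_const (xc vr)^-1.
    by rewrite (rmorph_nat frac_const) fmorphV.
  apply: localizedD; last exact: localized_const.
  by apply: localizedM (localized_tofrac _ _); apply: localizedM; exact: localized_const.
- by exists 2%N; eexists; exact: tws_num.
Qed.

Lemma localized_twisted v f : localized Delta f -> localized Delta (T v f).
Proof.
move=> Ef; apply: localizedD; last exact: localizedM (localized_tw v) Ef.
apply: localized_der Ef; last exact: derM.
by rewrite monic_neq0 // char_poly_monic.
Qed.

Lemma twisted_const v a h :
  T (Some v) (frac_const a * h) = frac_const a * T (Some v) h + frac_const (dK (enum_rank v) a) * h.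
Proof. by rewrite /twisted derLM derL_const; ring. Qed.

Lemma twisted_s_const a h : T None (frac_const a * h) = frac_const a * T None h.
Proof. by rewrite /twisted derLM derLs_const; ring. Qed.

Lemma twistedL_comm v w g : T v (T w g) = T w (T v g).
Proof.
apply: (twistedC derLM derL_coord two_neq0_frac coordL_r_neq0 resolventE) => a; exact: derLC.
Qed.

(** Integrands whose integral over s vanishes formally; functions regular off the zeros of [Delta],
    modulo these, form a twisted de Rham cohomology. *)
Definition exact_form (g : L) : Prop := exists2 f, localized Delta f & g = T None f.

Lemma exact_form0 : exact_form 0.
Proof.
exists 0; last by rewrite /twisted raddf0 mulr0 addr0.
by rewrite -tofrac0; exact: localized_tofrac.
Qed.

Lemma exact_formD g h : exact_form g -> exact_form h -> exact_form (g + h).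
Proof.
move=> [f Ef ->] [k Ek ->]; exists (f + k); first exact: localizedD.
by rewrite /twisted raddfD; ring.
Qed.

Lemma exact_formZ a g : exact_form g -> exact_form (frac_const a * g).
Proof.
move=> [f Ef ->]; exists (frac_const a * f); last by rewrite twisted_s_const.
exact: localizedM (localized_const a) Ef.
Qed.

(** Differentiation under the integral sign: [T v] commutes with [T None] and creates no new
    poles. *)
Lemma exact_form_twisted v g : exact_form g -> exact_form (T v g).
Proof.
move=> [f Ef ->]; exists (T v f); last exact: twistedL_comm.
exact: localized_twisted.
Qed.

Definition action (i : 'I_M) : {additive L -> L} := T (Some (enum_val i)).

Lemma actionM i a h : action i (frac_const a * h) =
  frac_const a * action i h + frac_const (dK i a) * h.
Proof. by have := twisted_const (enum_val i) a h; rewrite enum_valK. Qed.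

Lemma actionC i j h : action i (action j h) = action j (action i h).
Proof. exact: twistedL_comm. Qed.

(** [Q] applied to the integrand, divided by the integrand; modulo exact forms this represents [Q]
    applied to the integral. *)
Definition period (Q : diffop dK) : L := act frac_const action 1 Q.

Lemma period_is_additive : zmod_morphism period.
Proof. exact: act_is_additive. Qed.
HB.instance Definition _ := GRing.isZmodMorphism.Build (diffop dK) L period period_is_additive.

Lemma periodZ a Q : period (a *: Q) = frac_const a * period Q.
Proof. exact: actZ. Qed.

Lemma period_partial v Q : period (partial dK (enum_rank v) * Q) = T (Some v) (period Q).
Proof. by rewrite /period (act_partial actionM actionC) /action /= enum_rankK. Qed.

Lemma period_closed P Q : exact_form (period Q) -> exact_form (period (P * Q)).
Proof.
apply: (act_closed actionM actionC).
- exact: exact_form0.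
- exact: exact_formD.
- exact: exact_formZ.
- by move=> i; exact: exact_form_twisted.
Qed.

Lemma exact_period0 Q : period Q = 0 -> exact_form (period Q).
Proof. by move->; exact: exact_form0. Qed.

Lemma exact_periodD P Q : exact_form (period P) -> exact_form (period Q) ->
  exact_form (period (P + Q)).
Proof. by rewrite raddfD; exact: exact_formD. Qed.

Local Notation pd v := (partial dK (enum_rank v)).

Lemma period1 : period 1 = 1. Proof. exact: act1. Qed.

Lemma period_d v : period (pd v) = T (Some v) 1.
Proof. by rewrite -[pd v]mulr1 period_partial period1. Qed.

Lemma period_dd i j : period (pd (vy i) * pd (vy j)) = mom i j.
Proof.
rewrite period_partial period_d.
exact: (twisted_yy derLM derL_coord two_neq0_frac resolventE).
Qed.

Lemma period_dy i : period (pd (vy i)) = tw (Some (vy i)).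
Proof. by rewrite period_d (twisted1 coordL derLM). Qed.

Local Notation d i := (pd (vy i)).
Local Notation x i j := (xc (vx i j)).

Lemma period_xx i j : period (pd (vx i j) - d i * d j) = 0.
Proof.
rewrite raddfB /= period_d period_dd.
by rewrite (twisted_xx derLM resolventE) subrr.
Qed.

Lemma period_sphere : exact_form (period (\sum_i d i * d i - (xc vr ^+ 2)%:A)).
Proof.
(* The primitive [- 1] is read off from [sum_moment]. *)
exists (- 1); first exact/localizedN/localized_tofrac.
rewrite raddfB raddf_sum /= periodZ period1 mulr1 (rmorphXn frac_const) raddfN /=.
under eq_bigr do rewrite period_dd.
by rewrite (sum_moment coordL derLM resolvent) addrC addKr.
Qed.

Lemma period_rot (i j : idx) : i != j -> period
  (x i j *: (d i * d i) + (2 * (x j j - x i i)) *: (d i * d j) - x i j *: (d j * d j)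
  + \sum_(s | (s != i) && (s != j)) (x s j *: (d i * d s) - x i s *: (d j * d s))
  + xc (vy j) *: d i - xc (vy i) *: d j) = 0.
Proof.
move=> ij; set Q := \sum_(s | _) _.
have periodQ : period Q = \sum_(s | (s != i) && (s != j))
    (frac_const (x s j) * mom i s - frac_const (x i s) * mom j s).
  rewrite raddf_sum /=; apply: eq_bigr => s _.
  by rewrite raddfB /= !periodZ !period_dd.
rewrite raddfB !raddfD raddfN /= periodQ !periodZ !period_dd !period_dy.
rewrite (rmorphM frac_const) (rmorphB frac_const) (rmorph_nat frac_const).
exact: (moment_rot two_neq0_frac resolventE ij).
Qed.

Lemma period_euler : exact_form (period
  (xc vr *: pd vr - \sum_(i : idx) \sum_(j : idx | (i <= j)%N) (2 * x i j) *: (d i * d j)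
   - \sum_i xc (vy i) *: d i - n%:R%:A)).
Proof.
(* The primitive [2 s] is the one in [moment_euler]. *)
exists (2 * coordL None).
  by rewrite -(rmorph_nat frac_const); exact: localizedM (localized_const 2) (localized_tofrac _ _).
have -> : T None (2 * coordL None) = 2 * T None (coordL None).
  by rewrite -(rmorph_nat frac_const) twisted_s_const.
rewrite -(moment_euler derLM derL_coord two_neq0_frac coordL_r_neq0 resolventE).
set Q1 := \sum_i \sum_(j | _) _; set Q2 := \sum_i _ *: d i.
have pQ1 : period Q1 = \sum_(i : idx) \sum_(j : idx | (i <= j)%N) 2 * frac_const (x i j) * mom i j.
  rewrite raddf_sum /=; apply: eq_bigr => i _; rewrite raddf_sum /=; apply: eq_bigr => j _.
  by rewrite periodZ period_dd (rmorphM frac_const) (rmorph_nat frac_const).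
have pQ2 : period Q2 = \sum_i frac_const (xc (vy i)) * tw (Some (vy i)).
  by rewrite raddf_sum /=; apply: eq_bigr => i _; rewrite periodZ period_dy.
by rewrite !raddfB /= pQ1 pQ2 !periodZ period1 mulr1 period_d (rmorph_nat frac_const).
Qed.

(* Poles of order at most 2 and decay at infinity: such a combination cannot be
   a nonzero twisted derivative. *)
Lemma period_free (a b : idx -> K) :
  coprimep Delta (pole_coef quad_mx lin_col) ->
  exact_form (period (\sum_i (a i *: d i + b i *: (d i * d i)))) ->
  \sum_i (a i *: num1 quad_mx lin_col 2^-1 i + b i *: num2 quad_mx lin_col 2^-1 i) = 0.
Proof.
move=> cop [f Ef Pf].
pose h : {poly K} :=
  \sum_i (a i *: num1 quad_mx lin_col 2^-1 i + b i *: num2 quad_mx lin_col 2^-1 i).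
rewrite -/h; apply: (@twisted_derivative_neq0 K n.+1 Delta
  (twist_num quad_mx lin_col 2^-1) (xc vr ^+ 2) (tw None) _ _ _ _ _ tws_num f) => //.
- exact: char_poly_monic.
- exact: size_char_poly.
- exact: size_twist_num.
(* Modulo [Delta] the numerator of the twist is a nonzero constant times [pole_coef], which is
   coprime to [Delta]. *)
- have -> : twist_num quad_mx lin_col 2^-1
      = - (2^-1 *: \sum_i \adj (char_poly_mx quad_mx) i i) * Delta
        + (- 2^-1 ^+ 2) *: pole_coef quad_mx lin_col.
    by rewrite /twist_num opprD addrC mulNr -scalerAl scaleNr.
  by rewrite coprimep_addl_mul coprimepZr // oppr_eq0 expf_neq0 ?invr_eq0.
- exact: expf_neq0.
- apply: leq_trans (size_sum _ _ _) _; apply/bigmax_leqP => i _.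
  apply: leq_trans (size_polyD _ _) _; rewrite geq_max.
  apply/andP; split; apply: leq_trans (size_scale_leq _ _) _.
    exact: size_num1.
  exact: size_num2.
have DE : frac_der (@deriv K) f = derL None f.
  by rewrite /derL /= /poly_ders_fun unlift_none.
rewrite DE -/(T None f) -Pf raddf_sum mulr_suml rmorph_sum; apply: eq_bigr => i _ /=.
rewrite raddfD /= !periodZ period_dd period_dy mulrDl.
by rewrite -[X in X + _]mulrA -[X in _ + X]mulrA tw_num mom_num !const_mul_poly tofracD.
Qed.

End Cohomology.

(** * The rank *)

Section Rank.
Variables (F : fieldType) (n : nat).
Hypothesis charF : [pchar F] =i pred0.
Local Notation idx := 'I_n.+1.
Local Notation M := #|{: fb_var n}|.
Local Notation A := {mpoly F[M]}.
Local Notation K := {fraction A}.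
Local Notation U := (rat_weyl F M).
Local Notation tof := (@FracField.tofrac A).
Local Notation vx i j := (inl (inl (sort_pair i j))).
Local Notation vy i := (inl (inr i)).
Local Notation vr := (inr tt).
Local Notation d i := (rat_partial F (vy i)).
Local Notation dK := (frac_ders (poly_der F M)).
Local Notation xc := (@rat_coord F n).

(** A lift of [quad_mx] to polynomial entries, which can be both embedded in [K] and evaluated at
    the point. *)
Definition poly_quad_mx : 'M[A]_n.+1 :=
  \matrix_(i, j) (poly_coord F (vx i j) * ((i != j).+1%:R^-1)%:MP).
Definition poly_lin_col : 'cV[A]_n.+1 := \col_i poly_coord F (vy i).
Definition poly_half : A := (2^-1)%:MP.

Lemma two_neq0F : 2 != 0 :> F.
Proof. by have /pcharf0P -> := charF. Qed.

Lemma natK k : k%:R = tof (k%:R)%:MP.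
Proof. by rewrite (rmorph_nat (@mpolyC M F)) (rmorph_nat tof). Qed.

Lemma natK_neq0 k : k.+1%:R != 0 :> K.
Proof. by rewrite natK tofrac_eq0 mpolyC_eq0; have /pcharf0P -> := charF. Qed.

Lemma tofrac_natV k : tof (k.+1%:R^-1)%:MP = k.+1%:R^-1.
Proof.
apply: (mulIf (natK_neq0 k)); rewrite mulVf ?natK_neq0 // natK -tofracM -mpolyCM.
by rewrite mulVf ?tofrac1 //; have /pcharf0P -> := charF.
Qed.

Lemma map_quad_mx : map_mx tof poly_quad_mx = quad_mx xc.
Proof.
by apply/matrixP=> i j; rewrite !mxE tofracM tofrac_natV.
Qed.

Lemma map_lin_col : map_mx tof poly_lin_col = lin_col xc.
Proof. by apply/matrixP=> i j; rewrite !mxE. Qed.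

Lemma ev_quad_mx : map_mx (ev_point F n) poly_quad_mx = diag_mx (\row_i i%:R).
Proof.
apply/matrixP=> i j; rewrite !mxE rmorphM ev_coord point_x /= mevalC.
by have [_|_] := eqVneq i j; rewrite ?mul0r ?invr1 ?mulr1 ?mulr1n ?mulr0n.
Qed.

Lemma ev_lin_col : map_mx (ev_point F n) poly_lin_col = const_mx 1.
Proof. by apply/matrixP=> i j; rewrite !mxE ev_coord. Qed.

Lemma point_inj : injective (fun i : idx => i%:R : F).
Proof. by move=> i j /(nat_inj charF)/val_inj. Qed.

Lemma coprimep_pole : coprimep (char_poly (quad_mx xc)) (pole_coef (quad_mx xc) (lin_col xc)).
Proof.
have := coprimep_specialize (ev := ev_point F n) (@tofrac_injective F n)
  (char_poly_monic poly_quad_mx) (pole_coef_shift_monic poly_quad_mx poly_lin_col).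
rewrite !rmorphD !rmorphXn /= !map_char_poly !map_pole_coef ev_quad_mx ev_lin_col.
rewrite map_quad_mx map_lin_col => /(_ (coprimep_diag point_inj)).
(* Removes the square that was added to obtain a monic polynomial. *)
by rewrite addrC expr2 coprimep_addl_mul.
Qed.

Lemma free_num (a b : idx -> K) :
  \sum_i (a i *: num1 (quad_mx xc) (lin_col xc) 2^-1 i
          + b i *: num2 (quad_mx xc) (lin_col xc) 2^-1 i) = 0 ->
  (forall i, a i = 0) /\ (forall i, b i = 0).
Proof.
(* Both kinds of numerators in one family: its length equals the bound on the sizes, as
   [free_specialize] demands. *)
pose P (k : 'I_(n.+1 + n.+1)) : {poly A} := match split k with
  | inl i => num1 poly_quad_mx poly_lin_col poly_half i
  | inr i => num2 poly_quad_mx poly_lin_col poly_half i end.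
have sP k : (size (P k) <= n.+1 + n.+1)%N.
  by rewrite addnn -mul2n /P; case: (split k) => i; [exact: size_num1 | exact: size_num2].
have sumP (E : fieldType) (g : {rmorphism A -> E}) (c : 'I_(n.+1 + n.+1) -> E) :
    \sum_k c k *: map_poly g (P k) = \sum_i
      (c (lshift n.+1 i) *: num1 (map_mx g poly_quad_mx) (map_mx g poly_lin_col) (g poly_half) i
       + c (rshift n.+1 i) *: num2 (map_mx g poly_quad_mx) (map_mx g poly_lin_col) (g poly_half) i).
  rewrite big_split_ord big_split /=; congr (_ + _); apply: eq_bigr => i _.
    by rewrite /P (unsplitK (inl i)) map_num1.
  by rewrite /P (unsplitK (inr i)) map_num2.
have half : tof poly_half = 2^-1 := tofrac_natV 1.
have evP (c : 'I_(n.+1 + n.+1) -> F) :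
    \sum_k c k *: map_poly (ev_point F n) (P k) = 0 -> forall k, c k = 0.
  rewrite sumP ev_quad_mx ev_lin_col /= mevalC => /(free_diag point_inj).
  rewrite invr_eq0 two_neq0F => /(_ isT)[cl cr] k.
  by rewrite -[k]splitK; case: (split k) => i; [exact: cl | exact: cr].
have fP := free_specialize (@tofrac_injective F n) sP evP.
move=> E; pose c k := match split k with inl i => a i | inr i => b i end.
have c0 : forall k, c k = 0.
  apply: fP; rewrite sumP map_quad_mx map_lin_col /= half -[RHS]E.
  by apply: eq_bigr => i _; rewrite /c (unsplitK (inl i)) (unsplitK (inr i)).
split=> i; first by have := c0 (lshift _ i); rewrite /c (unsplitK (inl i)).
by have := c0 (rshift _ i); rewrite /c (unsplitK (inr i)).
Qed.

(** The generators [fb_gen_xx] and [fb_gen_rot] have period zero, the sphere and Euler generators a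
    total derivative in s; left multiples follow from [period_closed]. *)
Lemma rat_ideal_period (Q : U) : rat_ideal Q -> exact_form dK xc (period (dK := dK) xc Q).
Proof.
have dxc := @dK_coord F n.
have r0 := @rat_coord_neq0 F n vr.
move: Q; apply: rat_ideal_min.
- by apply: exact_period0; exact: raddf0.
- by move=> P Q; exact: exact_periodD.
move=> P Q gQ; apply: (period_closed dxc (natK_neq0 1) r0).
case: gQ => [[i [j [_ ->]]]|->|[i [j [ij ->]]]|->].
- rewrite weyl_to_rat_xx; apply: exact_period0.
  exact: (period_xx dxc (natK_neq0 1) r0 i j).
- rewrite weyl_to_rat_sphere; exact: (period_sphere dxc (natK_neq0 1) r0).
- have nij : i != j by rewrite neq_ltn ij.
  rewrite weyl_to_rat_rot; apply: exact_period0.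
  exact: (period_rot dxc (natK_neq0 1) r0 nij).
- rewrite weyl_to_rat_euler; exact: (period_euler dxc (natK_neq0 1) r0).
Qed.

Lemma rat_free (a b : idx -> K) :
  rat_ideal (\sum_i (a i *: d i + b i *: (d i * d i))) ->
  (forall i, a i = 0) /\ (forall i, b i = 0).
Proof.
move=> /rat_ideal_period E; apply: free_num.
apply: (period_free (@dK_coord F n) (natK_neq0 1) (@rat_coord_neq0 F n vr)) => //.
exact: coprimep_pole.
Qed.

Theorem fisher_bingham_rank :
  has_holonomic_rank (@fisher_bingham_ideal F n) (n.+1 + n.+1).
Proof.
exists (fun k => match split k with inl i => d i | inr i => d i * d i end).
have sumE (c : 'I_(n.+1 + n.+1) -> K) :
    \sum_k c k *: match split k with inl i => d i | inr i => d i * d i end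
    = \sum_i (c (lshift _ i) *: d i + c (rshift _ i) *: (d i * d i)).
  rewrite big_split_ord big_split /=; congr (_ + _); apply: eq_bigr => i _.
    by rewrite (unsplitK (inl i)).
  by rewrite (unsplitK (inr i)).
split=> [P|c].
  have [a [b Wab]] := rat_span charF P.
  exists (fun k => match split k with inl i => a i | inr i => b i end).
  rewrite sumE; under eq_bigr => i _ do rewrite (unsplitK (inl i)) (unsplitK (inr i)).
  exact: Wab.
rewrite sumE => /rat_free[cl cr] k.
by rewrite -[k]splitK; case: (split k) => i; [exact: cl | exact: cr].
Qed.

End Rank.

Theorem theorem1 (R : realType) (n : nat) (n_ge1 : (1 <= n)%N) :
  has_holonomic_rank (@fisher_bingham_ideal R[i] n) (2 * n + 2).
Proof.
have -> : (2 * n + 2 = n.+1 + n.+1)%N by rewrite mul2n -addnn addn2 addnS.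
exact/fisher_bingham_rank/pchar_num.
Qed.
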